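(* Let $q$ be a power of a prime, $m$ a prime divisor of $q-1$, $k=\mathbb{F}_q(t)$, $S=\{D_1,\dots,D_l\}$ a finite set of nonzero polynomials in $\mathbb{F}_q[t]$, and $K=k(\sqrt[m]{D_1},\dots,\sqrt[m]{D_l})$. Let $\gamma_S$ be the cardinality of $$\{(a_1,\dots,a_l)\in\{0,\dots,m-1\}^l \mid D_1^{a_1}\cdots D_l^{a_l}=F^m \text{ for some } F\in\mathbb{F}_q[t]\},$$ and $r$ the non-negative integer with $m^r=\gamma_S$. Let $\mathscr{M}$ be the set of monic irreducible $P$ with $(D_1/P)_m=\cdots=(D_l/P)_m=1$. Then the Dirichlet density of $\mathscr{M}$ equals $1/m^{l-r}$. Moreover, if $K/k$ is a geometric extension (full constant field of $K$ is $\mathbb{F}_q$), then the relative density of $\mathscr{M}$ also equals $1/m^{l-r}$.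
   Context: For monic irreducible $P$ and $a\in\mathbb{F}_q[t]$ with $P\nmid a$, $(a/P)_m$ is the unique element of $\mathbb{F}_q^*$ with $a^{(q^{\deg P}-1)/m}\equiv(a/P)_m\pmod P$; if $P\mid a$, $(a/P)_m=0$. With $NP=q^{\deg P}$, the Dirichlet density of a set $T$ of monic irreducibles is $\lim_{s\to1^+}\sum_{P\in T}NP^{-s}/\sum_P NP^{-s}$. The relative density is $\lim_{N\to\infty}\#\{P\in T:\deg P=N\}/\pi(N)$, where $\pi(N)$ is the number of monic irreducibles of degree $N$. *)

(* Defs.v *)
From HB Require Import structures.
From mathcomp Require Import all_boot all_order all_algebra all_field finmap.
From mathcomp Require Import all_classical all_reals all_analysis.

Set Implicit Arguments.
Unset Strict Implicit.
Unset Printing Implicit Defensive.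

Import Order.TTheory GRing.Theory Num.Theory.
Import numFieldTopology.Exports numFieldNormedType.Exports.

Local Open Scope classical_set_scope.
Local Open Scope ring_scope.

Section FunctionFieldPrimes.
Variable F : finFieldType.
Implicit Types (P a : {poly F}) (T : set {poly F}).

Definition pdeg P : nat := (size P).-1.

Definition pnorm P : nat := (#|F| ^ pdeg P)%N.

Definition monic_irreducibles : set {poly F} :=
  [set P | P \is monic /\ irreducible_poly P].

(* For P monic irreducible not dividing a and m %| #|F|.-1, exactly one
   constant c satisfies the condition, so the default value of odflt is not
   used. *)
Definition residue_symbol (m : nat) a P : F :=
  if P %| a then 0
  else odflt 0 [pick c : F | (c != 0) &&
         (a ^+ ((pnorm P).-1 %/ m) %% P == c%:P %% P)].

Definition residue_class1 (m l : nat) (D : 'I_l -> {poly F}) : set {poly F} :=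
  [set P | monic_irreducibles P
           /\ forall i : 'I_l, residue_symbol m (D i) P = 1].

Definition gammaS (m l : nat) (D : 'I_l -> {poly F}) : nat :=
  #|[pred a : {ffun 'I_l -> 'I_m} |
      `[< exists G : {poly F}, \prod_(i < l) D i ^+ a i = G ^+ m >]]|.

(* The sum over T of NP^(-s); it is finite for s > 1 when T consists of monic
   polynomials that are irreducible, so fine does not discard anything. *)
Definition prime_zeta (R : realType) T (s : R) : R :=
  fine (\esum_(P in T) ((pnorm P)%:R `^ (- s))%:E).

Definition has_dirichlet_density (R : realType) T (d : R) : Prop :=
  prime_zeta T s / prime_zeta monic_irreducibles s @[s --> (1 : R)^'+] --> d.

Definition count_deg T (N : nat) : nat :=
  #|` fset_set [set P | T P /\ pdeg P = N]|.

Definition has_relative_density (R : realType) T (d : R) : Prop :=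
  (count_deg T N)%:R / (count_deg monic_irreducibles N)%:R @[N --> \oo] --> d.

Definition const_embed (K : fieldExtType {fraction {poly F}}) (c : F) : K :=
  (tofrac c%:P)%:A.

Definition geometric_extension (K : fieldExtType {fraction {poly F}}) : Prop :=
  forall z : K, algebraicOver (const_embed K) z <-> exists c, z = const_embed K c.

(* K = k(x_1, ..., x_l) with x_i an m-th root of D_i.  When m divides
   #|F|.-1 the m-th roots of unity lie in k, so K does not depend on the
   choice of the roots. *)
Definition radical_extension (m l : nat) (D : 'I_l -> {poly F})
    (K : fieldExtType {fraction {poly F}}) : Prop :=
  exists x : 'I_l -> K,
    (forall i, x i ^+ m = (tofrac (D i))%:A)
    /\ <<1 & [seq x i | i <- enum 'I_l]>>%VS = fullv.

End FunctionFieldPrimes.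

(* Main.v *)
(* Fix an m-th root of unity eps and E in F_q[t] that is not a constant times an
   m-th power, and put Q = q^N.  Stepanov's method bounds the number of P of
   degree N with E^((Q-1)/m) = eps mod P by (1/m + o(1)) Q/N: with kappa = q^h
   fixed, linear algebra over F_q produces
     R = sum_(a < m) sum_(j < J) r_(a,j)(t) t^(jQ) E^(a(Q-1)/m),
   deg r_(a,j) bounded independently of N, with P^kappa | R for all those P.
   Splitting the r_(a,j) E^(a(kappa-1)/m) along residues of exponents mod kappa
   writes R = sum_i t^i W_i^kappa, and P | W_i becomes a polynomial identity
   because t^Q = t and E^((Q-1)/m) = eps mod P; no derivatives are needed.
   R is nonzero for N large: replace t^Q by a second variable z and eliminate
   Y between sum h_a(t,z) Y^a and Y^m = E(z)/E(t); a common factor of degree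
   d < m would make (E(z)/E(t))^d an m-th power, hence E a constant times an
   m-th power.
   The m upper bounds add up to the prime polynomial theorem, so each is an
   asymptotic equality.  Summing the counts of {P : (D^a/P)_m = 1} over all
   exponent vectors a in (Z/m)^l counts the P that split completely m^l times
   and all other P m^(l-1) times, which gives the density along N.  If some D^a
   is c F^m with c not an m-th power, all P in question have degree divisible
   by m and the density along multiples of m is m times as large; this extra
   factor is averaged out by comparing with sum_N y^N/N, y = q^(1-s) -> 1. *)
Require Import Defs.
From HB Require Import structures.
From mathcomp Require Import all_boot all_order all_algebra all_field finmap.
From mathcomp Require Import fingroup cyclic.
From mathcomp Require Import all_classical all_reals all_analysis.
From mathcomp Require Import ring lra zify.

Set Implicit Arguments.
Unset Strict Implicit.
Unset Printing Implicit Defensive.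

Import Order.TTheory GRing.Theory Num.Theory.
Import numFieldTopology.Exports numFieldNormedType.Exports.

Local Open Scope ring_scope.

(** * Nonvanishing of the auxiliary polynomial *)

(** Bezout exponents with s d = t m + 1 rewrite the relation as: a constant times E times an m-th
    power is an m-th power. Divisibility between m-th powers passes to their bases, so the quotient
    is again an m-th power. *)
Lemma coprime_expr_eq (F : fieldType) (E U V : {poly F}) (b : F) (d m : nat) :
  (0 < m)%N -> coprime d m -> (0 < d)%N -> b != 0 -> V != 0 ->
  (b%:P * E) ^+ d * V ^+ m = U ^+ m ->
  exists (c : F) (G : {poly F}), E = c%:P * G ^+ m.
Proof.
move=> m0 cdm d0 b0 V0 eqU.
have [->|E0] := eqVneq E 0; first by exists 0, 0; rewrite mul0r.
case: (egcdnP m d0) => s t; rewrite (eqP cdm) => st _.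
have eqS : E * (b ^+ (s * d))%:P * (E ^+ t * V ^+ s) ^+ m = (U ^+ s) ^+ m.
  rewrite [RHS]exprAC -eqU !exprMn polyC_exp -!exprM (mulnC d s) st (mulnC m s).
  by rewrite [E ^+ (_ + 1)]exprD expr1; ring.
have W0 : E ^+ t * V ^+ s != 0 by rewrite mulf_neq0 ?expf_neq0.
have : (E ^+ t * V ^+ s) ^+ m %| (U ^+ s) ^+ m by rewrite -eqS dvdp_mulIr.
rewrite dvdp_pexp2r // => /dvdpP[G eG].
exists (b ^+ (s * d))^-1, G.
have -> : G ^+ m = E * (b ^+ (s * d))%:P 
  by apply: (mulIf (expf_neq0 m W0)); rewrite -exprMn -eG eqS.
by rewrite mulrCA -polyCM mulVf ?expf_neq0 // mulr1.
Qed.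

Lemma monic_char_poly (k : fieldType) (p : {poly k}) : p \is monic -> (1 < size p)%N ->
  exists n (A : 'M[k]_n.+1), char_poly A = p /\ size p = n.+2.
Proof.
move=> pm sp; have e : ((size p).-1 = (size p).-2.+1)%N by case: (size p) sp => [|[]].
have := companionmxK pm; move: (companionmx p); rewrite e => A hA.
by exists (size p).-2, A; split => //; case: (size p) sp => [|[]].
Qed.

(* The determinant of the companion matrix of the factor is the product of its roots. *)
Lemma dvdp_Xn_subC_power (k : fieldType) (c : k) (p : {poly k}) (m : nat) :
  (1 < size p)%N -> p %| 'X^m - c%:P -> exists e, e ^+ m = c ^+ (size p).-1.
Proof.
move=> sp pd; pose p1 := (lead_coef p)^-1 *: p.
have lp0 : (lead_coef p)^-1 != 0.
  by rewrite invr_eq0 lead_coef_eq0 -size_poly_gt0 (ltn_trans _ sp).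
have sp1 : size p1 = size p by rewrite size_scale.
have p1m : p1 \is monic by rewrite monicE lead_coefZ mulVf // -invr_eq0.
have p1d : p1 %| 'X^m - c%:P by rewrite dvdpZl.
case: (monic_char_poly p1m); first by rewrite sp1.
move=> n [A [cA sn]]; rewrite -sp1 sn /=; exists (\det A).
have /dvdpP := p1d => -[w /(congr1 (horner_mx A))].
rewrite -cA rmorphM /= Cayley_Hamilton mulr0 rmorphB /= rmorphXn /= horner_mx_X horner_mx_C.
move/eqP; rewrite subr_eq0 => /eqP Am.
have dX k0 : \det (A ^+ k0) = \det A ^+ k0.
  by elim: k0 => [|k0 IH]; rewrite ?expr0 ?det1 // !exprS -IH -det_mulmx.
by rewrite -dX Am det_scalar.
Qed.

Lemma fraction_numden (R : idomainType) (x : {fraction R}) :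
  exists u v : R, v != 0 /\ x * tofrac v = tofrac u.
Proof.
elim/quotW: x => x; exists (frac x).1, (frac x).2; split; first exact: denom_ratioP.
rewrite !piE /FracField.mulf /FracField.equivf.
apply/eqmodP => /=; rewrite FracField.equivfE !numden_Ratio ?mulf_neq0 ?oner_eq0 //.
  by rewrite !mulr1 mulrC.
all: exact: denom_ratioP.
Qed.

Section Bivariate.
Variable F : fieldType.
Implicit Types (E : {poly F}).

(* In {poly {poly F}} the outer variable is x and the inner one is z, which is
   later specialized to x^Q. *)
Definition in_x E : {poly {poly F}} := map_poly polyC E.

(** This is the m-th power of [E(x) Y] when Y^m = E(z)/E(x); rescaling Y in this way clears the
    denominator. *)
Definition kummer_const (m : nat) E : {poly {poly F}} := in_x E ^+ m.-1 * E%:P.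

Lemma lead_coef_in_x E : lead_coef (in_x E) = (lead_coef E)%:P.
Proof. by rewrite lead_coef_map_inj //; exact: polyC_inj. Qed.

(** A common factor of degree d with 0 < d < m makes c^d an m-th power in the fraction field.
    Comparing leading coefficients in x leaves a relation in z alone, to which [coprime_expr_eq]
    applies because m is prime. *)
Lemma resultant_kummer_neq0 (m : nat) E (H : {poly {poly {poly F}}}) :
  prime m -> (forall c G, E <> c%:P * G ^+ m) ->
  (1 < size H <= m)%N -> resultant H ('X^m - (kummer_const m E)%:P) != 0.
Proof.
move=> pm Enot /andP[sH1 sHm]; rewrite resultant_eq0 -leqNgt leqNgt; apply/negP.
set c := kummer_const m E; set g := gcdp _ _ => sg.
have m0 := prime_gt0 pm.
have E0 : E != 0 by apply/eqP => E0; apply: (Enot 0 0); rewrite mul0r.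
have H0 : H != 0 by rewrite -size_poly_gt0 (ltn_trans _ sH1).
have sgm : (size g <= m)%N by apply: leq_trans sHm; rewrite leq_gcdpl.
have /Pdiv.Idomain.dvdpP[[a w] /= a0 eqg] : g %| 'X^m - c%:P by exact: dvdp_gcdr.
pose f := map_poly (@tofrac {poly {poly F}}).
have sfg : size (f g) = size g.
  by rewrite size_map_inj_poly ?rmorph0 // => x y /eqP; rewrite tofrac_eq => /eqP.
(* Over the fraction field the pseudo-division scalar [a] is invertible, so the image of g is a true
   divisor of Y^m - c. *)
have fd : f g %| 'X^m - (tofrac c)%:P.
  have : (tofrac a) *: ('X^m - (tofrac c)%:P) = f w * f g.
    by rewrite -rmorphM /= -eqg /f map_polyZ rmorphB /= map_polyXn map_polyC.
  by move=> e; rewrite -(@dvdpZr _ (tofrac a)) ?tofrac_eq0 // e dvdp_mulIr.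
have [|e] := dvdp_Xn_subC_power _ fd; first by rewrite sfg.
rewrite sfg; set d := (size g).-1; have d0 : (0 < d)%N by rewrite /d; case: (size g) sg => [|[]].
have dm : (d < m)%N by rewrite /d prednK // (ltn_trans _ sg).
have [u [v [v0 euv]]] := fraction_numden e.
move=> /(congr1 (fun y => y * (tofrac v) ^+ m)); rewrite -exprMn euv -!tofracXn -tofracM.
move/eqP; rewrite tofrac_eq => /eqP euc.
have := congr1 lead_coef euc; rewrite lead_coefM !lead_coef_exp /c /kummer_const.
rewrite lead_coefM lead_coef_exp lead_coefC lead_coef_in_x -rmorphXn /= => /esym eL.
have [] := @coprime_expr_eq _ E (lead_coef u) (lead_coef v) (lead_coef E ^+ m.-1) d m m0 _ d0 _ _ eL.
- by rewrite coprime_sym prime_coprime // gtnNdvd.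
- by rewrite expf_neq0 // lead_coef_eq0.
- by rewrite lead_coef_eq0.
by move=> c0 [G]; exact: Enot.
Qed.

Definition specialize (Q : nat) : {poly {poly F}} -> {poly F} :=
  horner_eval 'X \o map_poly (comp_poly 'X^Q).

HB.instance Definition _ Q := GRing.RMorphism.on (specialize Q).

Lemma specializeC Q E : specialize Q E%:P = E \Po 'X^Q.
Proof. by rewrite /specialize /= map_polyC /= /horner_eval hornerC. Qed.

Lemma specialize_in_x Q E : specialize Q (in_x E) = E.
Proof.
rewrite /specialize /in_x /= /horner_eval -map_poly_comp_id0 ?rmorph0 ?comp_poly0 //.
rewrite (eq_map_poly (g := polyC)); first by rewrite -[RHS]comp_polyXr.
by move=> y /=; rewrite comp_polyC.
Qed.

(** When the degree in x is below Q, the exponent k Q + i determines both i and k, so distinct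
    monomials of W cannot cancel. The coefficient followed here is that of the leading monomial. *)
Lemma specialize_neq0 Q (W : {poly {poly F}}) :
  W != 0 -> (size W <= Q)%N -> specialize Q W != 0.
Proof.
move=> W0 sW; have Q0 : (0 < Q)%N by apply: leq_trans sW; rewrite size_poly_gt0.
pose i := (size W).-1; pose k := (size (W`_i)).-1.
have si : (i < size W)%N by rewrite /i prednK // size_poly_gt0.
suff: (specialize Q W)`_(k * Q + i) = (W`_i)`_k.
  move=> e; apply: contraTneq W0 => s0; move: e; rewrite s0 coef0 => /esym/eqP.
  by rewrite /k /i -/(lead_coef _) !lead_coef_eq0 => ->.
rewrite /specialize /= /horner_eval horner_coef coef_sum.
have sm : (size (map_poly (comp_poly 'X^Q) W) <= size W)%N by apply: size_poly.
rewrite (big_ord_widen _ (fun j : nat => ((map_poly (comp_poly 'X^Q) W)`_j * 'X^j)`_(k * Q + i)) sm).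
rewrite big_mkcond /= (bigD1 (Ordinal si)) //= big1 ?addr0; last first.
  move=> j ji; case: ifP => // _; rewrite coef_map_id0 ?comp_poly0 // coefMXn.
  case: ltnP => // jk; rewrite coef_comp_poly_Xn //; case: ifP => // dQ.
  case/eqP: ji; apply: val_inj => /=.
  have jQ := leq_trans (ltn_ord j) sW; have iQ := leq_trans si sW.
  have /eqP : (k * Q + i == j %[mod Q])%N by rewrite eqn_mod_dvd.
  by rewrite modnMDl !modn_small.
case: ifP => [_|/negbT]; last first.
  rewrite -leqNgt => sm'; have /eqP := W0; case.
  exfalso; move: sm'; rewrite leqNgt => /negP; apply.
  have : (map_poly (comp_poly 'X^Q) W)`_i != 0.
    rewrite coef_map_id0 ?comp_poly0 // comp_poly_eq0 ?size_polyXn // /i.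
    by rewrite -/(lead_coef _) lead_coef_eq0.
  by apply: contraNT; rewrite -leqNgt => ?; rewrite nth_default.
rewrite coef_map_id0 ?comp_poly0 // coefMXn ltnNge leq_addl /= addnK.
by rewrite coef_comp_poly_Xn // dvdn_mull // mulnK.
Qed.

End Bivariate.

Section Kummer.
Variables (F : finFieldType) (m : nat).
Hypotheses (m_prime : prime m) (m_dvd : (m %| #|F|.-1)%N).
Implicit Types (E P : {poly F}).

Definition kexp (N : nat) : nat := ((#|F| ^ N).-1 %/ m)%N.

Lemma kexpE N : (#|F| ^ N = (m * kexp N).+1)%N.
Proof.
rewrite /kexp mulnC divnK; first by rewrite prednK // expn_gt0 (ltnW (finNzRing_gt1 F)).
by rewrite predn_exp dvdn_mulr.
Qed.

Lemma expf_card_exp N (c : F) : c ^+ (#|F| ^ N) = c.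
Proof. by elim: N => [|N IH]; rewrite ?expn0 ?expr1 // expnSr exprM IH expf_card. Qed.

Lemma poly_frobenius N E : E ^+ (#|F| ^ N) = E \Po 'X^(#|F| ^ N).
Proof.
have [p pp pF] := finPcharP F.
have qn : [pchar {poly F}].-nat (#|F| ^ N)%N.
  rewrite pnatX (card_pprimeChar pF) pnatX (eq_pnat _ (pchar_poly F)).
  by rewrite (eq_pnat _ (pcharf_eq pF)) pnat_id.
elim/poly_ind: E => [|E c IH].
  by rewrite comp_poly0 expr0n expn_eq0 (gtn_eqF (ltnW (finNzRing_gt1 F))).
by rewrite comp_poly_MXaddC exprDn_pchar // exprMn IH -rmorphXn /= expf_card_exp.
Qed.

(** H itself serves when it is constant in Y, and the resultant otherwise. *)
Lemma exists_eliminant E (H : {poly {poly {poly F}}}) :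
  (forall c G, E <> c%:P * G ^+ m) -> H != 0 -> (size H <= m)%N ->
  exists W, W != 0 /\ exists u v : {poly {poly {poly F}}},
    W%:P = u * H + v * ('X^m - (kummer_const m E)%:P).
Proof.
move=> Enot H0 sH; have [sH1|sH1] := leqP (size H) 1.
  have eH := size1_polyC sH1; exists H`_0; rewrite -polyC_eq0 -eH; split => //.
  have E10 (R : pzRingType) (x y : R) : x = 1 * x + 0 * y by rewrite mul1r mul0r addr0.
  by exists 1, 0; exact: E10.
exists (resultant H ('X^m - (kummer_const m E)%:P)).
split; first by apply: resultant_kummer_neq0 => //; rewrite sH1.
case: (@resultant_in_ideal _ H ('X^m - (kummer_const m E)%:P)) => // [|uv _ ->].
  by rewrite size_XnsubC ?prime_gt0 // ltnS prime_gt0.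
by exists uv.1, uv.2.
Qed.

Section Auxiliary.
Variables (J B : nat) (E : {poly F}).
Implicit Types r : {ffun 'I_m * 'I_J -> {poly_B F}}.

Definition stepanov_poly N r : {poly F} :=
  \sum_(a < m) (\sum_(j < J) (r (a, j) : {poly F}) * 'X^(j * #|F| ^ N)) * E ^+ (a * kexp N).

Let row_xz r (a : 'I_m) : {poly {poly F}} :=
  \sum_(j < J) in_x (r (a, j)) * ('X^j)%:P.

(** The weight E(x)^(m-1-a) matches the rescaled variable of [kummer_const]: putting E^(kexp N + 1)
    for Y and x^(q^N) for z yields E^(m-1) times [stepanov_poly N r]. *)
Let stepanov_xz r : {poly {poly {poly F}}} :=
  \sum_(a < m) (row_xz r a * in_x E ^+ (m.-1 - a)) *: 'X^a.

Let size_stepanov_xz r : (size (stepanov_xz r) <= m)%N.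
Proof.
apply: (leq_trans (size_sum _ _ _)); apply/bigmax_leqP => a _.
by apply: (leq_trans (size_scale_leq _ _)); rewrite size_polyXn.
Qed.

Let stepanov_xz_neq0 r : E != 0 -> r != 0 -> stepanov_xz r != 0.
Proof.
move=> E0; apply: contraNneq => H0; apply/eqP/ffunP => -[a j]; rewrite ffunE.
apply/val_inj => /=; apply/polyP => k; rewrite coef0.
have /eqP : (stepanov_xz r)`_a = 0 by rewrite H0 coef0.
rewrite /stepanov_xz coef_sum (bigD1 a) //= big1 ?addr0; last first.
  by move=> b ba; rewrite coefZ coefXn (inj_eq val_inj) eq_sym (negbTE ba) mulr0.
have Ex0 : in_x E != 0 by rewrite -lead_coef_eq0 lead_coef_in_x polyC_eq0 lead_coef_eq0.
rewrite coefZ coefXn eqxx mulr1 mulf_eq0 (negbTE (expf_neq0 _ Ex0)) orbF.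
move=> /eqP /(congr1 (fun p : {poly {poly F}} => p`_k`_j)).
rewrite coef0 coef0 /row_xz coef_sum coef_sum (bigD1 j) //= big1 ?addr0 => [|i ij].
  by rewrite coefMC coef_map /= coefCM coefXn eqxx mulr1.
by rewrite coefMC coef_map /= coefCM coefXn (inj_eq val_inj) eq_sym (negbTE ij) mulr0.
Qed.

Let specialize_row N r a : specialize (#|F| ^ N) (row_xz r a) =
  \sum_(j < J) (r (a, j) : {poly F}) * 'X^(j * #|F| ^ N).
Proof.
rewrite /row_xz rmorph_sum; apply: eq_bigr => j _.
by rewrite rmorphM /= specialize_in_x specializeC comp_Xn_poly -exprM mulnC.
Qed.

Let horner_stepanov_xz N r :
  (map_poly (specialize (#|F| ^ N)) (stepanov_xz r)).[E ^+ (kexp N).+1] =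
  E ^+ m.-1 * stepanov_poly N r.
Proof.
rewrite rmorph_sum /= horner_sum /stepanov_poly mulr_sumr; apply: eq_bigr => a _.
rewrite map_polyZ /= map_polyXn hornerZ hornerXn rmorphM rmorphXn /=.
rewrite specialize_row specialize_in_x -mulrA [RHS]mulrCA -exprM -!exprD.
congr (_ * _ ^+ _); rewrite mulSn addnA subnK; last by rewrite -ltnS prednK ?prime_gt0.
by rewrite mulnC.
Qed.

(** Rests on m (kexp N + 1) = q^N + m - 1 and on E^(q^N) = E(x^(q^N)). *)
Let horner_kummer N :
  (map_poly (specialize (#|F| ^ N)) ('X^m - (kummer_const m E)%:P)).[E ^+ (kexp N).+1] = 0.
Proof.
rewrite rmorphB /= map_polyXn map_polyC /= hornerD hornerN hornerXn hornerC.
rewrite /kummer_const rmorphM rmorphXn /= specialize_in_x specializeC -poly_frobenius.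
rewrite -exprM -exprD kexpE addnS -addSn prednK ?prime_gt0 // mulSn mulnC.
by rewrite subrr.
Qed.

(** At the common point of the two evaluations above, the eliminant W becomes a multiple of
    [stepanov_poly N r]. If the latter vanished, W would specialize to 0, which a large q^N
    excludes. The r form a finite type, so one N0 serves all of them. *)
Lemma stepanov_poly_neq0 : (forall c G, E <> c%:P * G ^+ m) ->
  exists N0, forall N r, (N0 <= N)%N -> r != 0 -> stepanov_poly N r != 0.
Proof.
move=> Enot.
have E0 : E != 0 by apply/eqP => E0; apply: (Enot 0 0); rewrite mul0r.
have /fin_all_exists[W WP] : forall r : {ffun 'I_m * 'I_J -> {poly_B F}},
    exists W : {poly {poly F}}, r != 0 -> W != 0 /\ exists u v : {poly {poly {poly F}}},
      W%:P = u * stepanov_xz r + v * ('X^m - (kummer_const m E)%:P).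
  move=> r; have [->|r0] := eqVneq r 0; first by exists 0.
  have [W WP] := exists_eliminant Enot (stepanov_xz_neq0 E0 r0) (size_stepanov_xz r).
  by exists W.
exists (\max_r size (W r))%N => N r leN r0; apply/eqP => R0.
have [W0 [u [v]]] := WP r r0; have := horner_kummer N; move: (_ - _) => Phi hk eW.
have := congr1 (fun p => (map_poly (specialize (#|F| ^ N)) p).[E ^+ (kexp N).+1]) eW.
rewrite /= map_polyC hornerC rmorphD !rmorphM /= hornerD !hornerM.
rewrite horner_stepanov_xz hk R0 !mulr0 addr0; apply/eqP.
apply: specialize_neq0 => //.
have sW := leq_trans (leq_bigmax (F := fun r1 => size (W r1)) r) leN.
by rewrite (leq_trans sW) // ltnW // ltn_expl // finNzRing_gt1.
Qed.

End Auxiliary.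
End Kummer.

(** * Stepanov's bound *)

Section PrimePolynomials.
Variable F : finFieldType.
Implicit Types P E : {poly F}.
Local Notation q := #|F|.

Lemma residue_field P : P \is monic -> irreducible_poly P ->
  exists (L : finFieldType) (pi : {rmorphism {poly F} -> L}),
  [/\ #|L| = (q ^ (size P).-1)%N, forall f, (pi f == 0) = (P %| f)
    & forall y, exists f, pi f = y].
Proof.
move=> Pm Pi; pose hI : monic_irreducible_poly P := (Pi, Pm).
pose pi : {rmorphism {poly F} -> {poly %/ P with hI}} := in_qpoly P.
exists {poly %/ P with hI}, pi; split; first exact: card_qfpoly.
  move=> f; rewrite -(inj_eq val_inj) /= (mk_monicE hI).
  by rewrite Pdiv.Idomain.dvdpE.
move=> y; exists (val (y : {poly %/ P})); apply: val_inj => /=.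
apply: Pdiv.CommonRing.rmodp_small; exact: (size_mk_monic (y : {poly %/ P})).
Qed.

Lemma dvdp_Xq_subX P : P \is monic -> irreducible_poly P ->
  P %| 'X^(q ^ (size P).-1) - 'X.
Proof.
move=> Pm Pi; have [L [pi [cL kerpi _]]] := residue_field Pm Pi.
by rewrite -kerpi rmorphB rmorphXn /= -cL expf_card subrr.
Qed.

Definition primes_deg (N : nat) : seq {poly F} :=
  [seq P <- [seq val x | x : {poly_N.+1 F}] |
    [&& P \is monic, irreducibleb P & size P == N.+1]].

Lemma primes_degP N P :
  reflect [/\ P \is monic, irreducible_poly P & size P = N.+1] (P \in primes_deg N).
Proof.
rewrite mem_filter; apply: (iffP andP) => [[/and3P[Pm /irreducibleP Pi /eqP sP] _]|[Pm Pi sP]] //.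
split; first by apply/and3P; split => //; [apply/irreducibleP|apply/eqP].
apply/mapP; exists (npolyp N.+1 P); first by rewrite mem_enum.
by rewrite /= npolypK // sP.
Qed.

Lemma primes_deg_uniq N : uniq (primes_deg N).
Proof. by rewrite filter_uniq // map_inj_uniq ?enum_uniq //; exact: val_inj. Qed.

Lemma irredp_dvdp_exp P E n : irreducible_poly P -> P %| E ^+ n -> P %| E.
Proof.
move=> Pi; apply: contraLR; rewrite -irreducible_poly_coprime // => cPE.
have := coprimep_expr n cPE; rewrite irreducible_poly_coprime //.
Qed.

Lemma dvdp_prod_primes (s : seq {poly F}) k (R : {poly F}) : uniq s ->
  (forall P, P \in s -> [/\ P \is monic, irreducible_poly P & P ^+ k %| R]) ->
  \prod_(P <- s) P ^+ k %| R.
Proof.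
elim: s => [|P s IH] /=; first by rewrite big_nil dvd1p.
move=> /andP[Ps us] sP; rewrite big_cons.
have [Pm Pi PR] := sP P (mem_head _ _).
rewrite Gauss_dvdp ?PR ?IH //; first by move=> P' P's; apply: sP; rewrite in_cons P's orbT.
apply: coprimep_expl; rewrite big_seq; apply: (big_ind (coprimep P)) => [|x y|P' P's].
- exact: coprimep1.
- by rewrite coprimepMr => -> ->.
apply: coprimep_expr; rewrite irreducible_poly_coprime //.
have [P'm P'i _] : [/\ P' \is monic, irreducible_poly P' & P' ^+ k %| R].
  by apply: sP; rewrite in_cons P's orbT.
apply: contra Ps => PP'; have : P %= P' by apply: P'i => //; rewrite gtn_eqF //; case: Pi.
by rewrite eqp_monic // => /eqP ->.
Qed.

(** The powers P^k are pairwise coprime, so their product divides R and degrees can be compared. *)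
Lemma count_primes_dvdp N k (a : pred {poly F}) (R : {poly F}) : R != 0 ->
  (forall P, P \in primes_deg N -> a P -> P ^+ k %| R) ->
  (k * N * count a (primes_deg N) <= (size R).-1)%N.
Proof.
move=> R0 aR; have : \prod_(P <- [seq P <- primes_deg N | a P]) P ^+ k %| R.
  apply: dvdp_prod_primes; first exact/filter_uniq/primes_deg_uniq.
  move=> P; rewrite mem_filter => /andP[aP Ps]; have /primes_degP[? ? _] := Ps.
  by split => //; apply: aR.
move=> /(dvdp_leq R0) sR; rewrite -ltnS (prednK _) ?size_poly_gt0 //.
apply: leq_trans sR; have : forall P, P \in [seq P <- primes_deg N | a P] -> P \is monic /\ size P = N.+1.
  by move=> P; rewrite mem_filter => /andP[_ /primes_degP[]].
rewrite -size_filter; elim: [seq P <- _ | _] => [|P s IH] sP;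
  first by rewrite big_nil muln0 size_poly1.
have [Pm sPN] := sP P (mem_head _ _).
have Pkm : P ^+ k \is monic by rewrite monic_exp.
rewrite big_cons /= mulnS size_proper_mul; last first.
  rewrite (monicP Pkm) mul1r lead_coef_eq0; apply/negP => /eqP p0.
  have : forall P0, P0 \in s -> P0 \is monic /\ size P0 = N.+1.
    by move=> P' P's; apply: sP; exact: mem_behead.
  by move/IH; rewrite p0 size_poly0.
have -> : size (P ^+ k) = (k * N).+1 
  by rewrite mulnC -[N in RHS]/(N.+1.-1) -sPN -size_exp prednK // size_poly_gt0 monic_neq0.
by rewrite addSn /= ltn_add2l // IH // => P' P's; apply: sP; exact: mem_behead.
Qed.

End PrimePolynomials.

Lemma dvdp_sum (K : fieldType) I (s : seq I) (a : pred I) (f : I -> {poly K}) d :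
  (forall i, a i -> d %| f i) -> d %| \sum_(i <- s | a i) f i.
Proof.
move=> df; apply: (big_ind (fun p => d %| p)) => //.
by move=> x y; exact: dvdp_add.
Qed.

Lemma leq_pred2 a b : (a <= b -> a.-1 <= b.-1)%N.
Proof. by case: a b => [|a] [|b]. Qed.

Section Stepanov.
Variables (F : finFieldType) (m : nat).
Hypotheses (m_prime : prime m) (m_dvd : (m %| #|F|.-1)%N).
Implicit Types P E : {poly F}.
Local Notation q := #|F|.
Local Notation kexp := (kexp F m).

(** Thus E^(a kexp N) is E^(a kexp h), whose exponent does not involve N, times a q^h-th power. *)
Lemma kexpD h N : (h <= N)%N -> kexp N = (kexp h + q ^ h * kexp (N - h))%N.
Proof.
move=> hN; have m0 := prime_gt0 m_prime; apply/eqP; rewrite -(eqn_pmul2l m0) -eqSS.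
rewrite mulnDr -addSn -!kexpE // -{1}(subnKC hN) expnD {1}(kexpE m_dvd (N - h)).
by rewrite mulnS mulnCA.
Qed.

Variable h : nat.
Let kap := (q ^ h)%N.

Let kap_gt0 : (0 < kap)%N. Proof. by rewrite expn_gt0 (ltnW (finNzRing_gt1 F)). Qed.

(** The part of p at the exponents i + kap k, with these contracted to k. Elements of F are fixed by
    the kap-th power, so raising to it spreads the exponents out again; [size p] is just a
    convenient bound. *)
Definition slice (i : nat) (p : {poly F}) : {poly F} := \poly_(k < size p) p`_(i + kap * k).

Lemma coef_slice_exp i p k :
  (slice i p ^+ kap)`_k = if (kap %| k)%N then p`_(i + k) else 0.
Proof.
rewrite poly_frobenius coef_comp_poly_Xn //; case: ifP => // dk; rewrite coef_poly.
rewrite [(kap * _)%N]mulnC divnK //; case: ltnP => // sk; rewrite nth_default //.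
by rewrite (leq_trans sk) // (leq_trans (leq_div _ _)) // leq_addl.
Qed.

Lemma size_slice_exp i p : (size (slice i p ^+ kap) <= size p)%N.
Proof.
apply/leq_sizeP => k sk; rewrite coef_slice_exp; case: ifP => // _.
by rewrite nth_default // (leq_trans sk) // leq_addl.
Qed.

Lemma sum_slice p : p = \sum_(i < kap) 'X^i * slice i p ^+ kap.
Proof.
apply/polyP => n; rewrite coef_sum (bigD1 (Ordinal (ltn_pmod n kap_gt0))) //= big1 ?addr0.
  rewrite coefXnM coef_slice_exp ltnNge leq_mod /=.
  by rewrite -eqn_mod_dvd ?leq_mod // modn_mod eqxx subnKC // leq_mod.
move=> i; rewrite -val_eqE /= => ni; rewrite coefXnM coef_slice_exp; case: ltnP => // le_in.
by rewrite -eqn_mod_dvd // (modn_small (ltn_ord i)) eq_sym (negbTE ni).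
Qed.

Lemma sliceB i p p' : slice i (p - p') ^+ kap = slice i p ^+ kap - slice i p' ^+ kap.
Proof.
apply/polyP => k; rewrite coefB !coef_slice_exp; case: ifP; rewrite ?subr0 //.
by rewrite coefB.
Qed.

Section Conditions.
Variables (J B : nat) (E : {poly F}) (eps : F).
Implicit Types r : {ffun 'I_m * 'I_J -> {poly_B F}}.

(** Modulo an admissible P this is E^((m-1) kexp h) times W_i^kap, with t^(q^N) replaced by t and
    E^(a kexp N) by eps^a. The extra factor keeps all exponents of E nonnegative, and N no longer
    occurs. *)
Definition stepanov_cond r (i : nat) : {poly F} :=
  \sum_(a < m) \sum_(j < J) slice i ((r (a, j) : {poly F}) * E ^+ (a * kexp h)) ^+ kap *
    ('X^j * (eps ^+ a)%:P * E ^+ ((m.-1 - a) * kexp h)).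

Let D := (B + J + (size E).-1 * (m.-1 * kexp h))%N.

Lemma size_stepanov_cond r i : (size (stepanov_cond r i) <= D)%N.
Proof.
apply: (leq_trans (size_sum _ _ _)); apply/bigmax_leqP => a _.
apply: (leq_trans (size_sum _ _ _)); apply/bigmax_leqP => j _.
have a_le : (a <= m.-1)%N by rewrite -ltnS prednK ?prime_gt0.
have e1 : (m.-1 * kexp h = a * kexp h + (m.-1 - a) * kexp h)%N by rewrite -mulnDl subnKC.
apply: (leq_trans (size_polyMleq _ _)).
have s6 : (size ('X^j * (eps ^+ a)%:P * E ^+ ((m.-1 - a) * kexp h))%R <=
    j.+1 + (size E).-1 * ((m.-1 - a) * kexp h))%N.
  have s7 : (size ('X^j * (eps ^+ a)%:P)%R <= j.+1)%N.
    by rewrite mulrC mul_polyC (leq_trans (size_scale_leq _ _)) // size_polyXn.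
  apply: leq_trans (size_polyMleq _ _) (leq_trans (leq_pred2 (leq_add s7 (size_poly_exp_leq _ _))) _).
  by rewrite addSn addnS.
have s1 := leq_trans (size_slice_exp _ _) (leq_trans (size_polyMleq _ _)
  (leq_pred2 (leq_add (size_npoly (r (a, j))) (size_poly_exp_leq E (a * kexp h))))).
apply: leq_trans (leq_pred2 (leq_add (s1 i) s6)) _.
have arith b x y : (((b + x.+1).-1 + (j.+1 + y)).-1 <= b + J + (x + y))%N.
  by have := ltn_ord j; lia.
by rewrite /D e1 mulnDr; exact: arith.
Qed.

(** Pigeonhole in place of ranks: there are q^(B m J) families r and q^(kap D) possible values of
    the conditions. Two families with equal values have a difference in the kernel, since slices are
    additive after taking kap-th powers. *)
Lemma stepanov_cond_kernel : (kap * D < B * (m * J))%N ->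
  exists r, r != 0 /\ forall i, (i < kap)%N -> stepanov_cond r i = 0.
Proof.
move=> lt; pose f r : {ffun 'I_kap -> {poly_D F}} := [ffun i : 'I_kap => npolyp D (stepanov_cond r i)].
have : ~~ injectiveb f.
  apply/injectiveP => /leq_card; rewrite !card_ffun !card_npoly card_prod !card_ord.
  rewrite -!expnM leq_exp2l ?finNzRing_gt1 // leqNgt; move/negP; apply.
  by rewrite mulnC.
move=> /injectivePn[r [r' rr' fr]]; exists (r - r'); split; first by rewrite subr_eq0.
move=> i ik; have /(congr1 val) : f r (Ordinal ik) = f r' (Ordinal ik) by rewrite fr.
rewrite !ffunE /= !npolypK ?size_stepanov_cond // => /eqP; rewrite -subr_eq0 => /eqP <-.
rewrite /stepanov_cond -sumrB; apply: eq_bigr => a _; rewrite -sumrB; apply: eq_bigr => j _.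
by rewrite -mulrBl -sliceB -mulrBl !ffunE.
Qed.

Lemma size_stepanov_poly r N :
  ((size (stepanov_poly E N r)).-1 <= B + (J.-1 + (size E).-1) * q ^ N)%N.
Proof.
suff : (size (stepanov_poly E N r) <= (B + (J.-1 + (size E).-1) * q ^ N).+1)%N.
  by case: (size _).
apply: (leq_trans (size_sum _ _ _)); apply/bigmax_leqP => a _.
rewrite mulr_suml; apply: (leq_trans (size_sum _ _ _)); apply/bigmax_leqP => j _.
apply: (leq_trans (size_polyMleq _ _)).
have s2 : (size ((r (a, j) : {poly F}) * 'X^(j * q ^ N))%R <= B + j * q ^ N)%N.
  apply: (leq_trans (size_polyMleq _ _)); rewrite size_polyXn addnS leq_add2r.
  exact: size_npoly.
have s3 := size_poly_exp_leq E (a * kexp N).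
apply: leq_trans (leq_pred2 (leq_add s2 s3)) _.
have j1 : (j * q ^ N <= J.-1 * q ^ N)%N by rewrite leq_mul2r -ltnS (ltn_predK (ltn_ord j)) ltn_ord orbT.
have a1 : ((size E).-1 * (a * kexp N) <= (size E).-1 * q ^ N)%N.
  by rewrite leq_mul2l (kexpE m_dvd) ltnW ?orbT // ltnS leq_mul2r ltnW ?orbT.
rewrite mulnDl; lia.
Qed.

Lemma stepanov_dvd r N P : (h <= N)%N -> P \in primes_deg F N -> ~~ (P %| E) ->
  P %| E ^+ kexp N - eps%:P -> (forall i, (i < kap)%N -> stepanov_cond r i = 0) ->
  P ^+ kap %| stepanov_poly E N r.
Proof.
move=> hN /primes_degP[Pm Pi sP] PE Peps r0.
have PQ : P %| 'X^(q ^ N) - 'X by have := dvdp_Xq_subX Pm Pi; rewrite sP.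
have eQ : (q ^ N = q ^ (N - h) * kap)%N by rewrite -expnD subnK.
pose W i := \sum_(a < m) \sum_(j < J) slice i ((r (a, j) : {poly F}) * E ^+ (a * kexp h)) *
  ('X^(j * q ^ (N - h)) * E ^+ (a * kexp (N - h))).
have Wk i : W i ^+ kap = \sum_(a < m) \sum_(j < J)
    slice i ((r (a, j) : {poly F}) * E ^+ (a * kexp h)) ^+ kap *
    ('X^(j * q ^ N) * E ^+ (a * (kap * kexp (N - h)))).
  rewrite /kap poly_frobenius rmorph_sum; apply: eq_bigr => a _.
  rewrite rmorph_sum /=; apply: eq_bigr => j _; rewrite -poly_frobenius -/kap !exprMn.
  by rewrite -!exprM -mulnA -eQ -mulnA [(kap * _)%N]mulnC.
(* The slices of r_(a,j) E^(a kexp h) recombine by [sum_slice]; every other factor is already a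
   kap-th power. *)
have -> : stepanov_poly E N r = \sum_(i < kap) 'X^i * W i ^+ kap.
  under [RHS]eq_bigr => i _.
    rewrite Wk mulr_sumr; under eq_bigr => a _ do rewrite mulr_sumr.
    over.
  rewrite exchange_big /=; apply: eq_bigr => a _; rewrite mulr_suml exchange_big /=.
  apply: eq_bigr => j _; under eq_bigr => i _ do rewrite mulrA.
  rewrite -mulr_suml -sum_slice (kexpD hN) mulnDr exprD; ring.
apply: dvdp_sum => i _; apply: dvdp_mull; apply: dvdp_exp2r.
apply: (@irredp_dvdp_exp _ _ _ kap) => //.
(* As P does not divide E, W_i^kap may be multiplied by E^((m-1) kexp h) before testing
   divisibility. The product differs from the vanishing [stepanov_cond r i] by a multiple of P, term
   by term. *)
have cPE : coprimep P (E ^+ (m.-1 * kexp h)).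
  by apply: coprimep_expr; rewrite irreducible_poly_coprime.
rewrite -(Gauss_dvdpl _ cPE); have := r0 i (ltn_ord i).
move=> C0; rewrite -[X in P %| X]subr0 -C0 Wk mulr_suml /stepanov_cond -sumrB.
apply: dvdp_sum => a _; rewrite mulr_suml -sumrB; apply: dvdp_sum => j _.
rewrite -[X in X - _]mulrA -mulrBr; apply: dvdp_mull.
have a_le : (a <= m.-1)%N by rewrite -ltnS prednK ?prime_gt0.
have -> : E ^+ (m.-1 * kexp h) = E ^+ (a * kexp h) * E ^+ ((m.-1 - a) * kexp h).
  by rewrite -exprD -mulnDl subnKC.
rewrite [X in X - _](_ : _ = 'X^(j * q ^ N) * E ^+ (a * kexp N) * E ^+ ((m.-1 - a) * kexp h));
  last first.
  by rewrite (kexpD hN) mulnDr exprD -/kap; ring.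
rewrite -mulrBl; apply: dvdp_mulr.
have -> (x x' y y' : {poly F}) : x * y - x' * y' = (x - x') * y + x' * (y - y') by ring.
apply: dvdp_add.
  apply: dvdp_mulr; rewrite mulnC exprM subrXX; exact: dvdp_mulr.
by apply: dvdp_mull; rewrite mulnC exprM rmorphXn /= subrXX; exact: dvdp_mulr.
Qed.

End Conditions.

Lemma stepanov_bound E (eps : F) : (forall c G, E <> c%:P * G ^+ m) ->
  exists B N0, forall N, (N0 <= N)%N ->
  (kap * N * count (fun P => P %| E ^+ kexp N - eps%:P)%R (primes_deg F N) <=
     B + (kexp h + (size E).-1) * q ^ N)%N.
Proof.
move=> Enot; have E0 : E != 0 by apply/eqP => E0; apply: (Enot 0 0); rewrite mul0r.
(* J is the least number with m J > kap, and m J - kap = m - 1. Each unit of B therefore gains m - 1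
   unknowns over conditions, and B is taken large enough to outweigh the conditions that do not grow
   with it. *)
pose J := (kexp h).+1; pose B := (kap * (J + (size E).-1 * (m.-1 * kexp h))).+1.
have [N1 RN] := stepanov_poly_neq0 m_prime m_dvd J B Enot.
have [|r [r0 rC]] := @stepanov_cond_kernel J B E eps.
  have := prime_gt1 m_prime; have := kexpE m_dvd h; rewrite -/kap /B /J => -> m1.
  have -> : (m * (kexp h).+1 = (m * kexp h).+1 + m.-1)%N by lia.
  move: (m * kexp h)%N ((size E).-1 * _)%N => x y; nia.
(* The three summands ensure that R is nonzero, that h <= N, and that no P of degree N divides E. *)
exists B, (N1 + h + size E)%N => N leN.
apply: (@leq_trans (size (stepanov_poly E N r)).-1); last exact: size_stepanov_poly.
apply: count_primes_dvdp; first by apply: RN => //; lia.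
move=> P PN Peps; apply: (stepanov_dvd _ PN _ Peps rC); first by lia.
have /primes_degP[_ _ sP] := PN; apply/negP => /(dvdp_leq E0).
by rewrite sP ltnNge (leq_trans (leq_addl _ _) leN).
Qed.

End Stepanov.

(** * The prime polynomial theorem and power residue classes *)

Lemma exists_irreducible_factor (K : fieldType) (p : {poly K}) : (1 < size p)%N ->
  exists P, [/\ P \is monic, irreducible_poly P & P %| p].
Proof.
elim: {p}(size p) {-2}p (leqnn (size p)) => [|n IH] p sn sp; first by lia.
have [[r [sr1 srp rp]]|no] := EM (exists r : {poly K}, [/\ (1 < size r)%N, (size r < size p)%N & r %| p]).
  have [|P [Pm Pi Pr]] := IH r _ sr1; first by lia.
  by exists P; split => //; exact: dvdp_trans rp.
have p0 : p != 0 by rewrite -size_poly_gt0; lia.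
have lc0 : (lead_coef p)^-1 != 0 by rewrite invr_eq0 lead_coef_eq0.
exists ((lead_coef p)^-1 *: p); split; first by rewrite monicE lead_coefZ mulVf ?lead_coef_eq0.
  split; first by rewrite size_scale.
  move=> r sr rp; rewrite (eqp_trans _ (_ : p %= _)) //; last by rewrite eqp_sym eqp_scale.
  rewrite dvdpZr // in rp.
  have r0 : r != 0 by apply: contraTneq rp => ->; rewrite dvd0p.
  have sr0 : (0 < size r)%N by rewrite size_poly_gt0.
  rewrite -dvdp_size_eqp // eqn_leq dvdp_leq //= leqNgt; apply/negP => lt.
  by apply: no; exists r; split; rewrite // ltn_neqAle eq_sym sr.
by rewrite dvdpZl.
Qed.

(** Write f = h gcd(f, g). An irreducible factor of h would also divide g, hence gcd(f, g), and its
    square would divide f, against coprimality with the derivative; so h is constant. *)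
Lemma dvdp_of_irreducible_factors (K : fieldType) (f g : {poly K}) :
  f != 0 -> coprimep f f^`() ->
  (forall P, P \is monic -> irreducible_poly P -> P %| f -> P %| g) -> f %| g.
Proof.
move=> f0 cf fg; have /dvdpP[h eh] := dvdp_gcdl f g.
have [sh|sh] := ltnP 1 (size h).
  have [P [Pm Pi /dvdpP[w ew]]] := exists_irreducible_factor sh.
  have Pf : P %| f by rewrite eh ew -mulrA mulrCA dvdp_mulr.
  have /dvdpP[w' ew'] : P %| gcdp f g by rewrite dvdp_gcd Pf fg.
  have ef : f = P * (P * (w * w')) by rewrite eh ew ew'; ring.
  have Pf' : P %| f^`().
    rewrite ef derivM; apply: dvdp_add; last exact: dvdp_mulr.
    by rewrite mulrCA dvdp_mulr.
  have := coprimep_dvdr Pf cf; rewrite coprimep_sym => /(coprimep_dvdr Pf').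
  by rewrite coprimepp => /eqP s1; case: Pi; rewrite s1.
have h0 : h != 0 by apply: contraNneq f0 => h0; rewrite eh h0 mul0r.
apply: dvdp_trans (dvdp_gcdr f g); rewrite {1}eh (size1_polyC sh) mul_polyC dvdpZl //.
by apply: contraNneq h0 => e; rewrite (size1_polyC sh) e.
Qed.

Lemma prime_primitive_root (L : nzRingType) (m : nat) (x : L) :
  prime m -> x ^+ m = 1 -> x != 1 -> m.-primitive_root x.
Proof.
move=> pm xm x1; have [d dx dm] := prim_order_exists (prime_gt0 pm) xm.
move: pm => /primeP[_ /(_ _ dm)] /orP[] /eqP e; rewrite -?{1}e //; move: dx.
by rewrite e => /prim_expr_order; rewrite expr1 => e1; rewrite e1 eqxx in x1.
Qed.

(** The map a -> prod mu_i^(a_i) is a character of (Z/m)^l with values in the m-th roots of unity,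
    so its kernel is everything or has index m. The factor m on the left avoids a division. *)
Lemma card_char_kernel (L : fieldType) (m l : nat) (mu : 'I_l -> L) : prime m ->
  (forall i, mu i ^+ m = 1) ->
  (m * \sum_(a : {ffun 'I_l -> 'I_m}) (\prod_i mu i ^+ a i == 1%R)%R =
   m ^ l * (if [forall i, mu i == 1%R] then m else 1))%N.
Proof.
move=> pm mum; have m0 := prime_gt0 pm.
case: ifPn => [/forallP mu1|]; last rewrite negb_forall => /existsP[i0 mu0].
  rewrite mulnC (eq_bigr (fun=> 1%N)); first by rewrite sum1_card card_ffun !card_ord.
  by move=> a _; rewrite big1 ?eqxx // => i _; rewrite (eqP (mu1 i)) expr1n.
have mup := prime_primitive_root pm (mum i0) mu0.
pose f (a : {ffun 'I_l -> 'I_m}) := \prod_i mu i ^+ a i.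
have f1 a : f a ^+ m = 1.
  by rewrite -prodrXl big1 // => i _; rewrite exprAC mum expr1n.
(* Adding t to the coordinate i0 multiplies the value by mu_i0^t. As t runs over Z/m the value runs
   over all m-th roots of unity, so each orbit meets the kernel exactly once. *)
pose sh (t : nat) (a : {ffun 'I_l -> 'I_m}) : {ffun 'I_l -> 'I_m} :=
  [ffun i => if i == i0 then Ordinal (ltn_pmod (a i + t) m0) else a i].
have fsh t a : f (sh t a) = f a * mu i0 ^+ t.
  rewrite /f (bigD1 i0) //= [in RHS](bigD1 i0) //= ffunE eqxx /= expr_mod // exprD.
  rewrite -!mulrA; congr (_ * _); rewrite mulrC; congr (_ * _).
  by apply: eq_bigr => i ii0; rewrite ffunE (negbTE ii0).
have shI t : injective (sh t).
  move=> a b /ffunP e; apply/ffunP => i; have := e i; rewrite !ffunE.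
  case: eqP => // _ /(congr1 val) /= /eqP; rewrite eqn_modDr !modn_small //.
  by move/eqP/val_inj.
rewrite muln1; transitivity (\sum_a \sum_(t < m) (f a * mu i0 ^+ t == 1%R)%R)%N.
  rewrite exchange_big /= -[X in (X * _)%N](card_ord m) -sum_nat_const.
  apply: eq_bigr => t _; rewrite [LHS](reindex_inj (shI t)) /=.
  by apply: eq_bigr => a _; rewrite -fsh.
rewrite (eq_bigr (fun=> 1%N)); first by rewrite sum1_card card_ffun !card_ord.
move=> a _; have fa0 : f a != 0.
  by apply: contraTneq (oner_neq0 L) => fa; rewrite -(f1 a) fa expr0n (gtn_eqF m0) eqxx.
have [t ft] : {t : 'I_m | (f a)^-1 = mu i0 ^+ t} by apply: (prim_rootP mup);
  rewrite exprVn f1 invr1.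
rewrite (bigD1 t) //= big1 ?addn0; first by rewrite -ft divff // eqxx.
move=> u ut; case: eqP => // /(canRL (mulKf fa0)); rewrite mulr1 ft => /eqP.
rewrite (eq_prim_root_expr mup) !modn_small // => /eqP /val_inj e.
by rewrite e eqxx in ut.
Qed.

Section PrimePolynomialTheorem.
Variable F : finFieldType.
Implicit Types P : {poly F}.
Local Notation q := #|F|.
Local Notation primes_deg := (primes_deg F).

Let q_gt1 : (1 < q)%N := finNzRing_gt1 F.

Lemma natr_card_exp N : (0 < N)%N -> (q ^ N)%:R = 0 :> F.
Proof.
move=> N0; have [p pp pF] := finPcharP F; rewrite natrX (card_pprimeChar pF) natrX (pcharf0 pF).
rewrite -exprM expr0n muln_eq0 (gtn_eqF N0) orbF; case: eqP => // e.
by have := q_gt1; rewrite (card_pprimeChar pF) e.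
Qed.

Lemma dvdp_frobenius P n f : P %| 'X^(q ^ n) - 'X -> P %| f ^+ (q ^ n) - f.
Proof.
move=> PX; rewrite poly_frobenius; elim/poly_ind: f => [|f c IH];
  first by rewrite comp_poly0 subr0 dvdp0.
rewrite comp_poly_MXaddC.
have -> : (f \Po 'X^(q ^ n)) * 'X^(q ^ n) + c%:P - (f * 'X + c%:P) =
  ((f \Po 'X^(q ^ n)) - f) * 'X^(q ^ n) + f * ('X^(q ^ n) - 'X) by ring.
by apply: dvdp_add; [exact: dvdp_mulr|exact: dvdp_mull].
Qed.

Lemma size_Xq_subX n : (0 < n)%N -> size ('X^(q ^ n) - 'X : {poly F}) = (q ^ n).+1.
Proof.
move=> n0; rewrite size_polyDl ?size_polyXn // size_polyN size_polyX ltnS.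
by rewrite (leq_trans q_gt1) // -{1}(expn1 q) leq_exp2l.
Qed.

(** All q^(deg P) elements of the residue field are roots of X^(q^n) - X. *)
Lemma size_irreducible_factor P n : P \is monic -> irreducible_poly P -> (0 < n)%N ->
  P %| 'X^(q ^ n) - 'X -> ((size P).-1 <= n)%N.
Proof.
move=> Pm Pi n0 PX; have [L [pi [cL kerpi surj]]] := residue_field Pm Pi.
have sX : size ('X^(q ^ n) - 'X : {poly L}) = (q ^ n).+1.
  rewrite size_polyDl ?size_polyXn // size_polyN size_polyX ltnS.
  by rewrite (leq_trans q_gt1) // -{1}(expn1 q) leq_exp2l.
have X0 : ('X^(q ^ n) - 'X : {poly L}) != 0 by rewrite -size_poly_eq0 sX.
have := max_poly_roots X0 (rs := enum L); rewrite sX -cardE cL enum_uniq.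
move=> /(_ _ isT); rewrite ltnS leq_exp2l //; apply.
apply/allP => y _; have [f <-] := surj y.
rewrite rootE !hornerE -rmorphXn -rmorphB kerpi; exact: dvdp_frobenius.
Qed.

(** If d = deg P < N, then P divides X^(q^d) - X and X^(q^N) - X, hence X^(q^(N-d)) - X, and so d <=
    N - d. *)
Lemma size_irreducible_factor_half P N : P \is monic -> irreducible_poly P -> (0 < N)%N ->
  P %| 'X^(q ^ N) - 'X -> (size P).-1 = N \/ ((size P).-1 <= N./2)%N.
Proof.
move=> Pm Pi N0 PX; have dN := size_irreducible_factor Pm Pi N0 PX.
have [->|ne] := eqVneq (size P).-1 N; [by left|right].
have PXd := dvdp_Xq_subX Pm Pi.
have lt : (0 < N - (size P).-1)%N by rewrite subn_gt0 ltn_neqAle ne.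
suff /(size_irreducible_factor Pm Pi lt) : P %| 'X^(q ^ (N - (size P).-1)) - 'X by lia.
have eN : (q ^ N = q ^ (size P).-1 * q ^ (N - (size P).-1))%N by rewrite -expnD subnKC.
have := subrXX ('X^(q ^ (size P).-1) : {poly F}) 'X (q ^ (N - (size P).-1));
  rewrite -exprM -eN => e.
have : P %| 'X^(q ^ N) - 'X^(q ^ (N - (size P).-1)) by rewrite e dvdp_mulr.
move=> /(dvdp_sub PX); congr (P %| _); ring.
Qed.

Lemma prime_poly_upper N : (N * size (primes_deg N) <= q ^ N)%N.
Proof.
have [->//|N0] := posnP N.
have := @count_primes_dvdp F N 1 predT ('X^(q ^ N) - 'X);
  rewrite size_Xq_subX //= mul1n count_predT.
apply; first by rewrite -size_poly_eq0 size_Xq_subX.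
by move=> P /primes_degP[Pm Pi sP] _; have := dvdp_Xq_subX Pm Pi; rewrite expr1 sP.
Qed.

Lemma size_prod_monic (s : seq {poly F}) : all (fun P => P \is monic) s ->
  size (\prod_(P <- s) P) = (\sum_(P <- s) (size P).-1).+1.
Proof.
elim: s => [|P s IH] /=; first by rewrite !big_nil size_poly1.
move=> /andP[Pm sm]; rewrite !big_cons size_proper_mul ?(monicP Pm) ?mul1r.
  by rewrite IH // addnS /= -addSn prednK // size_poly_gt0 monic_neq0.
by rewrite lead_coef_eq0 -size_poly_eq0 IH.
Qed.

(** X^(q^N) - X has derivative -1, so it divides the product of its irreducible factors. Those of
    degree other than N have degree at most N/2, and all irreducibles of such degrees together
    contribute at most q^(N/2+1). *)
Lemma prime_poly_lower N : (q ^ N <= N * size (primes_deg N) + q ^ (N./2.+1))%N.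
Proof.
have [->|N0] := posnP N; first by rewrite mul0n add0n expn0 expn_gt0 ltnW.
have sX := size_Xq_subX N0.
have X0 : ('X^(q ^ N) - 'X : {poly F}) != 0 by rewrite -size_poly_eq0 sX.
have cX : coprimep ('X^(q ^ N) - 'X) ('X^(q ^ N) - 'X : {poly F})^`().
  rewrite derivB derivXn derivX -mulr_natr -polyC_natr natr_card_exp // mulr0 sub0r.
  by rewrite -[X in coprimep _ X]scaleN1r coprimepZr ?coprimep1 // oppr_eq0 oner_eq0.
pose s := primes_deg N ++ flatten [seq primes_deg d | d <- iota 0 N./2.+1].
have sm : all (fun P => P \is monic) s.
  apply/allP => P; rewrite mem_cat => /orP[/primes_degP[]//|/flatten_mapP[d _]].
  by move/primes_degP => [].
have : 'X^(q ^ N) - 'X %| \prod_(P <- s) P.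
  apply: dvdp_of_irreducible_factors => // P Pm Pi PX.
  have Ps : P \in s.
    have sP : size P = (size P).-1.+1 by rewrite prednK // size_poly_gt0 monic_neq0.
    rewrite mem_cat; case: (size_irreducible_factor_half Pm Pi N0 PX) => [e|le].
      by apply/orP; left; apply/primes_degP; split => //; rewrite sP e.
    apply/orP; right; apply/flatten_mapP; exists (size P).-1.
      by rewrite mem_iota /= add0n ltnS.
    by apply/primes_degP.
  by rewrite (perm_big _ (perm_to_rem Ps)) big_cons dvdp_mulr.
have P0 : \prod_(P <- s) P != 0 by rewrite -size_poly_eq0 size_prod_monic.
move/(dvdp_leq P0); rewrite sX size_prod_monic // ltnS => /leq_trans; apply.
have sumd d : (\sum_(P <- primes_deg d) (size P).-1 = d * size (primes_deg d))%N.
  rewrite big_seq (eq_bigr (fun _ => d)); last by move=> P /primes_degP[_ _ ->].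
  by rewrite -big_seq big_const_seq count_predT iter_addn_0.
rewrite /s; move: (N./2.+1) => k; rewrite big_cat /= sumd leq_add2l big_flatten /= big_map.
elim: k => [|n IH]; first by rewrite big_nil.
rewrite -addn1 iotaD big_cat /= big_seq1 sumd add0n addn1 expnS.
apply: leq_trans (leq_add IH (prime_poly_upper n)) _.
by rewrite addnn -mul2n leq_mul2r q_gt1 orbT.
Qed.

End PrimePolynomialTheorem.

(** * Primes of a given degree sorted by power residue class *)

Section KummerClasses.
Variables (F : finFieldType) (m : nat).
Hypotheses (m_prime : prime m) (m_dvd : (m %| #|F|.-1)%N).
Implicit Types P E : {poly F}.
Local Notation q := #|F|.
Local Notation kexp := (kexp F m).
Local Notation primes_deg := (primes_deg F).

Definition class_count (E : {poly F}) (c : F) (N : nat) : nat :=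
  count (fun P => P %| E ^+ kexp N - c%:P) (primes_deg N).

Lemma exists_primitive_root : exists w : F, q.-1.-primitive_root w.
Proof.
have q1 := finNzRing_gt1 F.
have /hasP[w _ wp] : has q.-1.-primitive_root (enum (predC1 (0 : F))).
  apply: has_prim_root; first by rewrite -subn1 subn_gt0.
  - apply/allP => x; rewrite mem_enum inE unity_rootE => x0.
    by rewrite -(inj_eq (mulfI x0)) mulr1 -exprS prednK ?expf_card // ltnW.
  - exact: enum_uniq.
  - by rewrite -cardE cardC1.
by exists w.
Qed.

Lemma exists_m_primitive_root : exists z : F, m.-primitive_root z.
Proof. by have [w wp] := exists_primitive_root; exists (w ^+ (q.-1 %/ m));
  exact: dvdn_prim_root. Qed.

Lemma unit_kexp (L : finFieldType) N (y : L) : #|L| = (q ^ N)%N -> y != 0 -> (y ^+ kexp N) ^+ m = 1.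
Proof.
move=> cL y0; apply: (mulfI y0); rewrite mulr1 -exprM -exprS mulnC -kexpE // -cL.
exact: expf_card.
Qed.

(** For N at least the size of E no P of degree N divides E, so E^(kexp N) reduces to exactly one
    m-th root of unity modulo each P. *)
Lemma sum_class_count E z N : m.-primitive_root z -> (size E <= N)%N -> E != 0 ->
  (\sum_(i < m) class_count E (z ^+ i) N = size (primes_deg N))%N.
Proof.
move=> zp sE E0; rewrite /class_count.
under eq_bigr => i _ do rewrite -sum1_count big_mkcond.
rewrite exchange_big /= -sum1_size [LHS]big_seq [RHS]big_seq;
  apply: eq_bigr => P /primes_degP[Pm Pi sP].
have [L [pi [cL kerpi _]]] := residue_field Pm Pi; rewrite sP /= in cL.
have piE : pi E != 0 by rewrite kerpi; apply/negP => /(dvdp_leq E0); rewrite sP ltnNge sE.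
have zLp : m.-primitive_root (pi z%:P) by rewrite (fmorph_primitive_root (pi \o polyC)).
have [i ei] := prim_rootP zLp (unit_kexp cL piE).
have PE j : (P %| E ^+ kexp N - (z ^+ j)%:P) = (pi z%:P ^+ i == pi z%:P ^+ j).
  by rewrite -kerpi rmorphB subr_eq0 rmorphXn /= ei polyC_exp rmorphXn.
rewrite (bigD1 i) //= big1 => [|j ji]; first by rewrite PE eqxx.
by rewrite PE (eq_prim_root_expr zLp) !modn_small // eq_sym (inj_eq val_inj) (negbTE ji).
Qed.

Lemma kexp_sum N : kexp N = (kexp 1 * \sum_(i < N) q ^ i)%N.
Proof.
have m0 := prime_gt0 m_prime; apply/eqP; rewrite -(eqn_pmul2l m0) mulnA.
have := kexpE m_dvd 1; have := kexpE m_dvd N; rewrite expn1 => eN e1.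
by have := predn_exp q N; rewrite eN {1}e1 /= => ->.
Qed.

(** Since c^(q^i) = c, the power residue symbol of a constant depends only on the degree of P. This
    is what makes the degrees divisible by m special. *)
Lemma expf_kexp (c : F) N : c ^+ kexp N = (c ^+ kexp 1) ^+ N.
Proof.
rewrite kexp_sum exprM; elim: N => [|N IH]; first by rewrite big_ord0 !expr0.
by rewrite big_ord_recr exprD IH exprSr expf_card_exp.
Qed.

Lemma expf_kexp_eq1 (c : F) : c != 0 -> c ^+ kexp 1 = 1 -> exists b, c = b ^+ m.
Proof.
move=> c0 c1; have [w wp] := exists_primitive_root.
have [|i ci] := prim_rootP wp (x := c).
  by have := expf_card c; rewrite -(ltn_predK (finNzRing_gt1 F)) exprS -[RHS]mulr1 => /(mulfI c0).
have ek : (q.-1 = m * kexp 1)%N by have := kexpE m_dvd 1; rewrite expn1 => ->.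
have : (m * kexp 1 %| i * kexp 1)%N by rewrite -ek (prim_order_dvd wp) exprM -ci c1.
have k0 : (0 < kexp 1)%N.
  by have := finNzRing_gt1 F; rewrite -[#|F|]expn1 (kexpE m_dvd); case: (kexp 1) => //;
    rewrite muln0.
rewrite dvdn_pmul2r // => /dvdnP[j ej]; exists (w ^+ j).
by rewrite ci ej exprM.
Qed.

(** Modulo P the m-th power contributes 1, so only c^(kexp N) matters and the class is everything or
    empty. *)
Lemma class_count_const (c : F) (G : {poly F}) N : c != 0 -> G != 0 -> (size G <= N)%N ->
  class_count (c%:P * G ^+ m) 1 N = if (c ^+ kexp 1) ^+ N == 1 then size (primes_deg N) else 0.
Proof.
move=> c0 G0 sG; rewrite /class_count -expf_kexp.
transitivity (count (fun=> c ^+ kexp N == 1) (primes_deg N)); last first.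
  by case: eqP => _; [exact: count_predT|exact: count_pred0].
apply: eq_in_count => P /primes_degP[Pm Pi sP].
have [L [pi [cL kerpi _]]] := residue_field Pm Pi; rewrite sP /= in cL.
have piG : pi G != 0 by rewrite kerpi; apply/negP => /(dvdp_leq G0); rewrite sP ltnNge sG.
rewrite -kerpi rmorphB subr_eq0 rmorphXn rmorphM rmorphXn /= exprMn exprAC (unit_kexp cL piG) mulr1.
by rewrite -!rmorphXn /= (inj_eq (fmorph_inj (pi \o polyC))).
Qed.

(** Double counting of pairs (a, P) by [card_char_kernel] with mu_i the residue of D_i^(kexp N): a
    completely split P is counted m^l times, any other m^(l-1) times. *)
Lemma class_count_double l (D : 'I_l -> {poly F}) N :
  (forall i, D i != 0) -> (forall i, (size (D i) <= N)%N) ->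
  let n := count (fun P => [forall i, P %| D i ^+ kexp N - 1]) (primes_deg N) in
  (m * \sum_(a : {ffun 'I_l -> 'I_m}) class_count (\prod_i D i ^+ a i) 1%R N =
   m ^ l * (m * n + (size (primes_deg N) - n)))%N.
Proof.
move=> D0 sD /=; rewrite /class_count; under eq_bigr => a _ do rewrite -sum1_count big_mkcond.
rewrite exchange_big /= big_distrr /= -(count_predC (fun P => [forall i, P %| D i ^+ kexp N - 1])).
rewrite addKn -!sum1_count !big_distrr /= mulnDr !big_distrr /=.
rewrite [X in (X + _)%N]big_mkcond [X in (_ + X)%N]big_mkcond -big_split /=.
rewrite [LHS]big_seq [RHS]big_seq; apply: eq_bigr => P /primes_degP[Pm Pi sP].
have [L [pi [cL kerpi _]]] := residue_field Pm Pi; rewrite sP /= in cL.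
have piD i : pi (D i) != 0 by rewrite kerpi; apply/negP => /(dvdp_leq (D0 i)); rewrite sP ltnNge sD.
have eD i : (P %| D i ^+ kexp N - 1) = (pi (D i) ^+ kexp N == 1).
  by rewrite -kerpi rmorphB rmorph1 rmorphXn subr_eq0.
have := card_char_kernel m_prime (fun i => unit_kexp cL (piD i)).
have -> : [forall i, pi (D i) ^+ kexp N == 1] = [forall i, P %| D i ^+ kexp N - 1].
  by apply: eq_forallb => i; rewrite eD.
rewrite [X in _ -> (m * X)%N = _](eq_bigr (fun a : {ffun 'I_l -> 'I_m} =>
  ((\prod_i (pi (D i) ^+ kexp N) ^+ a i == 1)%R : nat))).
  by move=> ->; case: [forall i, _]; rewrite /= ?muln1 ?addn0 ?add0n.
move=> a _; rewrite -kerpi rmorphB rmorph1 subr_eq0 rmorphXn rmorph_prod -prodrXl.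
rewrite (eq_bigr (fun i => (pi (D i) ^+ kexp N) ^+ a i)); first by case: eqP.
by move=> i _; rewrite rmorphXn /= exprAC.
Qed.

End KummerClasses.

(** * Asymptotics of the counts *)

Section RestrictedLimits.
Variable R : realType.
Implicit Types (A : pred nat) (u v : nat -> R).

(** Convergence along the indices in A, which will be all numbers, the multiples of m, or the
    numbers not divisible by m. *)
Definition tends A u (d : R) := forall e : R, 0 < e ->
  exists N0, forall N, (N0 <= N)%N -> A N -> `|u N - d| <= e.

Lemma tends_sub A A' u d : (forall N, A N -> A' N) -> tends A' u d -> tends A u d.
Proof.
by move=> sA ud e e0; have [N0 uN] := ud e e0; exists N0 => N N0N /sA; exact: uN.
Qed.

Lemma tends_eq A u v d N1 : (forall N, (N1 <= N)%N -> A N -> u N = v N) -> tends A u d -> tends A v d.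
Proof.
move=> uv ud e e0; have [N0 uN] := ud e e0; exists (maxn N0 N1) => N.
by rewrite geq_max => /andP[N0N N1N] AN; rewrite -uv //; exact: uN.
Qed.

Lemma tends_cst A d : tends A (fun=> d) d.
Proof. by move=> e e0; exists 0%N => N _ _; rewrite subrr normr0 ltW. Qed.

Lemma tendsD A u v c d : tends A u c -> tends A v d -> tends A (fun N => u N + v N) (c + d).
Proof.
move=> uc vd e e0; have e2 : 0 < e / 2 by rewrite divr_gt0.
have [N1 uN] := uc _ e2; have [N2 vN] := vd _ e2; exists (maxn N1 N2) => N.
rewrite geq_max => /andP[N1N N2N] AN; rewrite [e]splitr opprD addrACA.
by rewrite (le_trans (ler_normD _ _)) // lerD ?uN ?vN.
Qed.

Lemma tendsZ A u c k : tends A u c -> tends A (fun N => k * u N) (k * c).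
Proof.
move=> uc e e0; have k0 : 0 < `|k| + 1 by rewrite ltr_wpDl.
have [N0 uN] := uc (e / (`|k| + 1)) (divr_gt0 e0 k0); exists N0 => N N0N AN.
rewrite -mulrBr normrM; apply: (@le_trans _ _ (`|k| * (e / (`|k| + 1)))).
  by rewrite ler_wpM2l // uN.
by rewrite mulrA ler_pdivrMr // mulrDr mulr1 mulrC lerDl ltW.
Qed.

Lemma tends_sum A (I : finType) (u : I -> nat -> R) (c : I -> R) :
  (forall i, tends A (u i) (c i)) -> tends A (fun N => \sum_i u i N) (\sum_i c i).
Proof.
move=> uc; elim: (index_enum I) => [|i s IH].
  rewrite big_nil; apply: (@tends_eq _ (fun=> 0) _ _ 0); last exact: tends_cst.
  by move=> N _ _; rewrite big_nil.
rewrite big_cons; apply: (@tends_eq _ (fun N => u i N + \sum_(j <- s) u j N) _ _ 0);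
  last exact: tendsD.
by move=> N _ _; rewrite big_cons.
Qed.

Lemma tends_unique A u c d : (forall N0, exists2 N, (N0 <= N)%N & A N) ->
  tends A u c -> tends A u d -> c = d.
Proof.
move=> infA uc ud; apply/eqP; rewrite -subr_eq0 -normr_le0; apply/ler_addgt0Pl => e e0.
have e2 : 0 < e / 2 by rewrite divr_gt0.
have [N1 uN] := uc _ e2; have [N2 vN] := ud _ e2; have [N] := infA (maxn N1 N2).
rewrite geq_max => /andP[N1N N2N] AN; rewrite addr0 [e]splitr.
have -> : c - d = (c - u N) + (u N - d) by ring.
by rewrite (le_trans (ler_normD _ _)) // lerD ?vN // distrC uN.
Qed.

End RestrictedLimits.

Section NormalizedCounts.
Variables (R : realType) (F : finFieldType).
Local Notation q := #|F|.
Local Notation primes_deg := (primes_deg F).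

Let q_gt1 : (1 < q)%N := finNzRing_gt1 F.

(** By the prime polynomial theorem this has the same limit as the proportion of c N among all monic
    irreducibles of degree N. *)
Definition normalized (c : nat -> nat) (N : nat) : R := (N * c N)%:R / (q ^ N)%:R.

Lemma qN_gt0 N : 0 < (q ^ N)%:R :> R.
Proof. by rewrite ltr0n expn_gt0 ltnW. Qed.

Lemma normalized_ge0 c N : 0 <= normalized c N.
Proof. by rewrite divr_ge0. Qed.

Lemma normalized_le c c' N : (c N <= c' N)%N -> normalized c N <= normalized c' N.
Proof. by move=> cc; rewrite ler_pM2r ?invr_gt0 ?qN_gt0 // ler_nat leq_mul2l cc orbT. Qed.

Lemma normalized_sum (I : finType) (c : I -> nat -> nat) N :
  normalized (fun k => \sum_i c i k)%N N = \sum_i normalized (c i) N.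
Proof. by rewrite /normalized big_distrr /= natr_sum mulr_suml. Qed.

Definition prime_count N := size (primes_deg N).

Lemma normalized_prime_le1 N : normalized prime_count N <= 1.
Proof. by rewrite ler_pdivrMr ?qN_gt0 // mul1r ler_nat prime_poly_upper. Qed.

Lemma normalized_prime_tends : tends predT (normalized prime_count) 1.
Proof.
move=> e e0; pose K := (Num.trunc (2 / e)).+1.
have eK : 2 / e < K%:R by rewrite truncnS_gt.
exists K => N KN _; have N0 : (0 < N)%N by apply: leq_trans KN.
rewrite distrC ger0_norm ?subr_ge0 ?normalized_prime_le1 // lerBlDr.
(* The error q^(N/2+1) in the lower bound is at most 2 q^N / N, hence at most e q^N once N >=
   2/e. *)
have le2 : (q ^ (N./2.+1) * N <= 2 * q ^ N)%N.
  have : (N - N./2 <= q ^ (N - N./2.+1))%N.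
    have -> : (N - N./2 = (N - N./2.+1).+1)%N by lia.
    exact: ltn_expl.
  have -> : (q ^ N = q ^ (N./2.+1) * q ^ (N - N./2.+1))%N by rewrite -expnD; congr (_ ^ _)%N; lia.
  move=> le; rewrite mulnCA leq_mul2l; apply/orP; right.
  by apply: (@leq_trans (2 * (N - N./2))); [lia|rewrite leq_mul2l].
have := prime_poly_lower F N; rewrite -(ler_nat R) natrD => lo.
have Qpos := qN_gt0 N; set Q := (q ^ N)%:R : R in Qpos lo *.
have N0R : 0 < N%:R :> R by rewrite ltr0n.
have eN : 2 <= e * N%:R.
  by rewrite mulrC -ler_pdivrMr // (le_trans (ltW eK)) // ler_nat.
have leQ : (q ^ N./2.+1)%:R <= e * Q.
  rewrite -(ler_pM2r N0R) -natrM (@le_trans _ _ (2 * Q)) //; first by rewrite -natrM ler_nat.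
  by rewrite mulrAC ler_pM2r.
rewrite -(ler_pM2r Qpos) mul1r mulrDl /normalized divfK ?gt_eqF //.
by rewrite (le_trans lo) // addrC lerD2r.
Qed.

Section Kummer.
Variable m : nat.
Hypotheses (m_prime : prime m) (m_dvd : (m %| q.-1)%N).

(** The main term of Stepanov's bound is (kexp h + deg E)/q^h, with kexp h <= q^h/m. First h makes
    deg E/q^h small; B depends on h, so N is taken large only afterwards to absorb B. *)
Lemma normalized_class_upper (E : {poly F}) (c : F) : (forall c0 G, E <> c0%:P * G ^+ m) ->
  forall e : R, 0 < e -> exists N0, forall N, (N0 <= N)%N ->
    normalized (class_count m E c) N <= m%:R^-1 + e.
Proof.
move=> Enot e e0; have m0 : 0 < m%:R :> R by rewrite ltr0n prime_gt0.
have e2 : 0 < e / 2 by rewrite divr_gt0.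
pose h := (Num.trunc ((size E).-1%:R / (e / 2))).+1.
have eh : (size E).-1%:R / (e / 2) < h%:R by rewrite truncnS_gt.
have [B [N1 bnd]] := stepanov_bound m_prime m_dvd h c Enot.
pose K := (Num.trunc (B%:R / (e / 2))).+1.
have eK : B%:R / (e / 2) < K%:R by rewrite truncnS_gt.
exists (maxn N1 K) => N; rewrite geq_max => /andP[N1N KN].
have Qpos := qN_gt0 N; set Q := (q ^ N)%:R : R in Qpos *.
have kpos := qN_gt0 h; set kap := (q ^ h)%:R : R in kpos *.
have := bnd N N1N; rewrite -/(class_count m E c N) -(ler_nat R) natrD !natrM natrD -/Q -/kap => le.
have Bk : B%:R <= e / 2 * (kap * Q).
  rewrite -ler_pdivrMl // mulrC (le_trans (ltW eK)) // (@le_trans _ _ N%:R) ?ler_nat //.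
  rewrite /kap /Q -natrM ler_nat (@leq_trans (q ^ N)%N) ?leq_pmull ?expn_gt0 1?ltnW //.
  exact: ltn_expl.
have sk : (size E).-1%:R <= e / 2 * kap.
  rewrite -ler_pdivrMl // mulrC (le_trans (ltW eh)) // ler_nat ltnW //; exact: ltn_expl.
have kk : (kexp F m h)%:R <= m%:R^-1 * kap.
  by rewrite -(ler_pM2l m0) mulrA divff ?gt_eqF // mul1r -natrM ler_nat (kexpE m_dvd h) leqnSn.
rewrite /normalized natrM -/Q ler_pdivrMr // -(ler_pM2l kpos) mulrA (le_trans le) //.
have split_e (a b k x : R) : k * ((b + (a + a)) * x) = a * (k * x) + (b * k + a * k) * x by ring.
rewrite [e]splitr split_e.
by rewrite lerD // ler_pM2r // lerD.
Qed.

(** The m classes add up to a total that tends to 1, so the upper bounds for the other m - 1 classes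
    bound the remaining one from below. *)
Lemma normalized_class_tends (E : {poly F}) : (forall c0 G, E <> c0%:P * G ^+ m) ->
  tends predT (normalized (class_count m E 1)) m%:R^-1.
Proof.
move=> Enot e e0; have m_gt0 := prime_gt0 m_prime.
have m0 : 0 < m%:R :> R by rewrite ltr0n.
have E0 : E != 0 by apply/eqP => E0; apply: (Enot 0 0); rewrite mul0r.
have [z zp] := exists_m_primitive_root m_dvd.
(* An error e/m in each of the m - 1 upper bounds and in the prime polynomial theorem adds up to
   e. *)
have em : 0 < e / m%:R by rewrite divr_gt0.
have /fin_all_exists[N0 up] : forall i : 'I_m, exists N0, forall N, (N0 <= N)%N ->
    normalized (class_count m E (z ^+ i)) N <= m%:R^-1 + e / m%:R.
  by move=> i; exact: normalized_class_upper.
have [N1 p1] := normalized_prime_tends em.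
exists (\max_i N0 i + N1 + size E)%N => N leN _.
have upN (i : 'I_m) : normalized (class_count m E (z ^+ i)) N <= m%:R^-1 + e / m%:R.
  by apply: up; apply: leq_trans (leq_bigmax i) _; lia.
pose i0 := Ordinal m_gt0.
have := p1 N; rewrite ler_norml => /(_ _ isT) /andP[|lo _]; first by lia.
have sumE : \sum_(i < m) normalized (class_count m E (z ^+ i)) N = normalized prime_count N.
  rewrite -normalized_sum /normalized; congr ((_ * _)%:R / _).
  by apply: sum_class_count => //; lia.
have em1 : e / m%:R <= e by rewrite ler_pdivrMr // ler_peMr ?(ltW e0) // ler1n.
have up0 := upN i0; rewrite expr0 in up0.
have le1 : \sum_(i < m | i != i0) normalized (class_count m E (z ^+ i)) N <=
    (m%:R - 1) * (m%:R^-1 + e / m%:R).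
  rewrite (le_trans (ler_sum _ (fun i _ => upN i))) // sumr_const cardC1 card_ord.
  by rewrite -[_ *+ m.-1]mulr_natl -subn1 natrB.
have eqm : (m%:R - 1) * (m%:R^-1 + e / m%:R) = (1 - m%:R^-1 + e) - e / m%:R.
  by field; rewrite gt_eqF.
rewrite eqm in le1; move: sumE; rewrite (bigD1 i0) //= expr0.
by move=> sumE; rewrite ler_norml; apply/andP; split; lra.
Qed.

Lemma normalized_power_tends (A : pred nat) (c : F) (G : {poly F}) : c != 0 -> G != 0 ->
  (forall N, A N -> c ^+ kexp F m 1 ^+ N = 1) ->
  tends A (normalized (class_count m (c%:P * G ^+ m) 1)) 1.
Proof.
move=> c0 G0 cA; apply: (@tends_eq _ _ (normalized prime_count) _ _ (size G)).
  move=> N sN AN; rewrite /normalized class_count_const // (cA N AN) eqxx //.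
exact: tends_sub (normalized_prime_tends).
Qed.

Lemma normalized_nonpower_tends (A : pred nat) (c : F) (G : {poly F}) : c != 0 -> G != 0 ->
  (forall N, A N -> c ^+ kexp F m 1 ^+ N != 1) ->
  tends A (normalized (class_count m (c%:P * G ^+ m) 1)) 0.
Proof.
move=> c0 G0 cA; apply: (@tends_eq _ _ (fun=> 0) _ _ (size G)); last exact: tends_cst.
move=> N sN AN; rewrite /normalized class_count_const // (negbTE (cA N AN)).
by rewrite muln0 mul0r.
Qed.

(** * Multiplicative relations among the [D i] and the density of completely split primes *)

Section MultiplicativeRelations.
Variables (l : nat) (D : 'I_l -> {poly F}).
Hypothesis D_neq0 : forall i, D i != 0.

Let D_exp (a : {ffun 'I_l -> 'I_m}) : {poly F} := \prod_i D i ^+ a i.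

Definition power_relation := [pred a | `[< exists G, D_exp a = G ^+ m >]].
(** A vector in this set but not in [power_relation] yields a constant that is not an m-th power but
    acquires an m-th root in K. *)
Definition const_power_relation := [pred a | `[< exists c G, D_exp a = c%:P * G ^+ m >]].

Definition split_count (N : nat) : nat :=
  count (fun P => [forall i, P %| D i ^+ kexp F m N - 1]) (primes_deg N).

(** Equal to 1/m^(l-r) once gamma_S = m^r. *)
Definition relation_density : R := (gammaS m D)%:R / (m ^ l)%:R.

Let m_gt0 : 0 < m%:R :> R. Proof. by rewrite ltr0n prime_gt0. Qed.
Let m_gt1 : 1 < m%:R :> R. Proof. by rewrite ltr1n prime_gt1. Qed.
Let ml_gt0 : 0 < (m ^ l)%:R :> R. Proof. by rewrite ltr0n expn_gt0 prime_gt0. Qed.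

Lemma power_relation_const a : power_relation a -> const_power_relation a.
Proof. by move=> /asboolP[G e]; apply/asboolP; exists 1, G; rewrite mul1r. Qed.

Lemma D_exp_neq0 a : D_exp a != 0.
Proof. by apply/prodf_neq0 => i _; rewrite expf_neq0. Qed.

Lemma const_power_relationP a : const_power_relation a ->
  exists c G, [/\ c != 0, G != 0 & D_exp a = c%:P * G ^+ m].
Proof.
move=> /asboolP[c [G e]]; exists c, G; have := D_exp_neq0 a; rewrite e mulf_eq0 negb_or.
by rewrite polyC_eq0 expf_eq0 prime_gt0 //= => /andP[].
Qed.

(** Here c is not an m-th power, so c^(kexp 1) is a nontrivial m-th root of unity, of exact order m
    because m is prime. *)
Lemma strict_relationP a : const_power_relation a -> ~~ power_relation a ->
  exists c G, [/\ c != 0, G != 0, D_exp a = c%:P * G ^+ m &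
    forall N, (c ^+ kexp F m 1 ^+ N == 1) = (m %| N)%N].
Proof.
move=> /const_power_relationP[c [G [c0 G0 e]]] na; exists c, G; split => // N.
have xm : (c ^+ kexp F m 1) ^+ m = 1 by apply: (unit_kexp m_dvd); rewrite ?expn1.
rewrite (prim_order_dvd (prime_primitive_root m_prime xm _)) //.
apply: contra na => /eqP /(expf_kexp_eq1 m_dvd c0)[b cb]; apply/asboolP.
by exists (b%:P * G); rewrite exprMn e cb rmorphXn.
Qed.

(** The identity of [class_count_double], normalized and solved for the number of completely split
    P. *)
Lemma split_count_tends (A : pred nat) (phi : {ffun 'I_l -> 'I_m} -> R) :
  (forall a, tends A (normalized (class_count m (D_exp a) 1)) (phi a)) ->
  tends A (normalized split_count) ((m%:R / (m ^ l)%:R * \sum_a phi a - 1) / (m%:R - 1)).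
Proof.
move=> fphi; have m1 : m%:R - 1 != 0 :> R by rewrite subr_eq0 gt_eqF.
have lim := tendsZ (m%:R - 1)^-1 (tendsD (tendsZ (m%:R / (m ^ l)%:R) (tends_sum fphi))
  (tendsZ (-1) (@tends_sub _ A predT _ _ (fun _ _ => isT) normalized_prime_tends))).
rewrite [X in tends _ _ X]mulrC; rewrite mulN1r in lim.
apply: (tends_eq (N1 := \max_i size (D i)) _ lim) => N sN _.
have sD i : (size (D i) <= N)%N by apply: leq_trans sN; exact: leq_bigmax.
have := class_count_double m_prime m_dvd D_neq0 sD;
  rewrite -/(split_count N) => /(congr1 (fun k => k%:R : R)).
have le : (split_count N <= prime_count N)%N by exact: count_size.
rewrite natrM natrM natrD natrM natrB // natr_sum => e.
rewrite -normalized_sum /normalized !natrM natr_sum.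
have Q0 : (q ^ N)%:R != 0 :> R by rewrite gt_eqF ?qN_gt0.
have M0 : (m ^ l)%:R != 0 :> R by rewrite gt_eqF.
apply: (mulfI m1); rewrite mulrA divff // mul1r.
rewrite /prime_count; move: e M0 Q0;
  move: (m ^ l)%:R (q ^ N)%:R (\sum_a _) (split_count N)%:R (size _)%:R.
move=> M Q S n p e M0 Q0.
have -> : S = M * (m%:R * n + (p - n)) / m%:R by rewrite -e mulrAC divff ?mul1r // gt_eqF.
by field; rewrite M0 Q0 gt_eqF.
Qed.

Lemma sum_indicator (p : pred {ffun 'I_l -> 'I_m}) (x y : R) :
  \sum_a (if p a then x else y) = #|p|%:R * x + ((m ^ l)%:R - #|p|%:R) * y.
Proof.
rewrite (bigID p) /= (eq_bigr (fun=> x)) => [|a ->//].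
rewrite [X in _ + X](eq_bigr (fun=> y)) => [|a /negbTE ->//].
have cT : #|{ffun 'I_l -> 'I_m}| = (m ^ l)%N by rewrite card_ffun !card_ord.
rewrite !sumr_const -(mulr_natl x) -(mulr_natl y) -cT; congr (_ * _ + _ * _).
by rewrite -natrB ?max_card // -(cardC p) addKn.
Qed.

Lemma gammaSE : gammaS m D = #|power_relation|.
Proof. by []. Qed.

Lemma power_relation_tends a (A : pred nat) : power_relation a ->
  tends A (normalized (class_count m (D_exp a) 1)) 1.
Proof.
move=> /asboolP[G e]; rewrite e -[G ^+ m]mul1r; apply: normalized_power_tends => //.
- exact: oner_neq0.
- by apply: contraNneq (D_exp_neq0 a) => G0; rewrite e G0 expr0n (gtn_eqF (prime_gt0 m_prime)).
- by move=> N _; rewrite !expr1n.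
Qed.

Lemma nonconst_relation_tends a (A : pred nat) : ~~ const_power_relation a ->
  tends A (normalized (class_count m (D_exp a) 1)) m%:R^-1.
Proof.
move=> na; apply: (@tends_sub _ _ predT) => //; apply: normalized_class_tends => // c G e.
by move/negP: na; apply; apply/asboolP; exists c, G.
Qed.

Lemma split_count_geometric :
  (forall a, const_power_relation a -> power_relation a) ->
  tends predT (normalized split_count) relation_density.
Proof.
move=> H; have := @split_count_tends predT (fun a => if power_relation a then 1 else m%:R^-1).
rewrite sum_indicator -gammaSE /relation_density.
have -> : (m%:R / (m ^ l)%:R * ((gammaS m D)%:R * 1 + ((m ^ l)%:R - (gammaS m D)%:R) / m%:R) - 1) /
    (m%:R - 1) = (gammaS m D)%:R / (m ^ l)%:R :> R.
  move: m_gt0 m_gt1 ml_gt0; move: (m ^ l)%:R (gammaS m D)%:R => M g m0 m1 M0.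
  by field; rewrite !gt_eqF // subr_gt0.
apply=> a; case: ifPn => [/power_relation_tends|na]; first by apply.
by apply: nonconst_relation_tends; apply: contra na => /H.
Qed.

Lemma split_count_nongeometric a0 : const_power_relation a0 -> ~~ power_relation a0 ->
  (exists N0, forall N, (N0 <= N)%N -> ~~ (m %| N)%N -> split_count N = 0%N) /\
  tends (dvdn m) (normalized split_count) (m%:R * relation_density).
Proof.
move=> c0 p0; have zero : exists N0, forall N, (N0 <= N)%N -> ~~ (m %| N)%N -> split_count N = 0%N.
  have [c [G [cn0 G0 e cN]]] := strict_relationP c0 p0.
  exists (size G) => N sG mN; have := class_count_const m_prime m_dvd cn0 G0 sG.
  rewrite cN (negbTE mN) -e => /eqP; rewrite -leqn0 => e0; apply/eqP; rewrite -leqn0.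
  apply: leq_trans e0; rewrite /split_count /class_count; apply: sub_count => P /forallP PD.
  rewrite -prodrXl polyC1; apply: (big_ind (fun x => P %| x - 1)) => [|x y Px Py|i _].
  - by rewrite subrr dvdp0.
  - have -> : x * y - 1 = x * (y - 1) + (x - 1) by ring.
    by apply: dvdp_add => //; exact: dvdp_mull.
  - rewrite exprAC -(expr1n {poly F} (a0 i)) subrXX; exact: dvdp_mulr.
split => //.
(* Along the N not divisible by m, the limit 0 can also be computed from the class limits: power
   relations contribute 1, relations holding only up to a constant 0, all other vectors 1/m.
   Uniqueness of the limit shows that exactly m gamma_S vectors are relations up to a constant. *)
have t1 : tends (fun N => ~~ (m %| N)%N) (normalized split_count) 0.
  have [N0 z] := zero; apply: (@tends_eq _ _ (fun=> 0) _ _ N0); last exact: tends_cst.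
  by move=> N N0N mN; rewrite /normalized z // muln0 mul0r.
have t2 := @split_count_tends (fun N => ~~ (m %| N)%N)
  (fun a => (if const_power_relation a then 0 else m%:R^-1) + (if power_relation a then 1 else 0)).
have {}t2 := tends_unique _ t1 (t2 _).
have card1 : #|const_power_relation|%:R = m%:R * (gammaS m D)%:R :> R.
  have : 0 = (m%:R / (m ^ l)%:R *
      \sum_a ((if const_power_relation a then 0 else m%:R^-1) +
        (if power_relation a then 1 else 0)) - 1) / (m%:R - 1) :> R.
    apply: t2 => [N0|a].
      exists (N0 * m).+1; last by rewrite -addn1 dvdn_addr ?dvdn_mull // gtnNdvd // prime_gt1.
      by rewrite leqW // leq_pmulr // prime_gt0.
    case: ifPn => [ca|na]; last first.
      rewrite ifN ?addr0; first exact: nonconst_relation_tends.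
      by apply: contra na; exact: power_relation_const.
    case: ifPn => [pa|na]; first by rewrite add0r; exact: power_relation_tends.
    have [c [G [cn0 G0 e cN]]] := strict_relationP ca na.
    by rewrite addr0 e; apply: normalized_nonpower_tends => // N; rewrite cN.
  rewrite big_split /= !sum_indicator -gammaSE => /esym/eqP.
  rewrite mulf_eq0 invr_eq0 [m%:R - 1 == 0]gt_eqF ?subr_gt0 // orbF subr_eq0.
  move: m_gt0 ml_gt0; move: (m ^ l)%:R (gammaS m D)%:R (#|_|%:R) => M g h m0 M0 /eqP e.
  have : m%:R / M * (h * 0 + (M - h) / m%:R + (g * 1 + (M - g) * 0)) * M = M by rewrite e mul1r.
  have -> : m%:R / M * (h * 0 + (M - h) / m%:R + (g * 1 + (M - g) * 0)) * M = M - h + m%:R * g.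
    by field; rewrite !gt_eqF.
  lra.
(* In degrees divisible by m every nonzero constant has symbol 1, so all relations up to a constant
   now have class limit 1. *)
have := @split_count_tends (dvdn m) (fun a => if const_power_relation a then 1 else m%:R^-1).
rewrite sum_indicator card1 /relation_density.
have -> : (m%:R / (m ^ l)%:R * (m%:R * (gammaS m D)%:R * 1 +
      ((m ^ l)%:R - m%:R * (gammaS m D)%:R) / m%:R) - 1) /
    (m%:R - 1) = m%:R * ((gammaS m D)%:R / (m ^ l)%:R) :> R.
  move: m_gt0 m_gt1 ml_gt0; move: (m ^ l)%:R (gammaS m D)%:R => M g m0 m1 M0.
  by field; rewrite !gt_eqF // subr_gt0.
apply=> a; case: ifPn => [ca|na]; last exact: nonconst_relation_tends.
have [pa|na] := boolP (power_relation a); first exact: power_relation_tends.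
have [c [G [cn0 G0 e cN]]] := strict_relationP ca na.
by rewrite e; apply: normalized_power_tends => // N mN; apply/eqP; rewrite cN.
Qed.

End MultiplicativeRelations.
End Kummer.
End NormalizedCounts.

(** * Translation to the statement *)

Local Open Scope classical_set_scope.

Section Translation.
Variables (F : finFieldType) (m : nat).
Hypotheses (m_prime : prime m) (m_dvd : (m %| #|F|.-1)%N).
Local Notation q := #|F|.

Lemma kexp_gt0 N : (0 < N)%N -> (0 < kexp F m N)%N.
Proof.
move=> N0; have : (1 < q ^ N)%N by rewrite -(expn0 q) ltn_exp2l // finNzRing_gt1.
by rewrite (kexpE m_dvd); case: (kexp F m N) => //; rewrite muln0.
Qed.

(** If P divides D both sides fail, because the exponent is positive; otherwise the congruence says
    that the constant picked is 1. *)
Lemma residue_symbol_eq1 (D P : {poly F}) : P \is monic -> irreducible_poly P ->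
  residue_symbol m D P = 1 <-> P %| D ^+ kexp F m (size P).-1 - 1.
Proof.
move=> Pm Pi; have [L [pi [cL kerpi _]]] := residue_field Pm Pi.
have k0 : (0 < kexp F m (size P).-1)%N by rewrite kexp_gt0 //; case: Pi; case: (size P) => [|[]].
have piE (f g : {poly F}) : (f %% P == g %% P) = (pi f == pi g).
  by rewrite -subr_eq0 -modpN -modpD -/(P %| f - g) -kerpi rmorphB subr_eq0.
have piC (c : F) : (pi c%:P == 1) = (c == 1).
  by rewrite -(rmorph1 (pi \o polyC)) (inj_eq (fmorph_inj (pi \o polyC))).
have -> : (P %| D ^+ kexp F m (size P).-1 - 1) = (pi (D ^+ kexp F m (size P).-1) == 1).
  by rewrite -kerpi rmorphB rmorph1 subr_eq0.
rewrite /residue_symbol; case: ifPn => [PD|nPD].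
  split=> [/esym/eqP|]; first by rewrite oner_eq0.
  by move: PD; rewrite -kerpi rmorphXn => /eqP ->; rewrite expr0n (gtn_eqF k0) eq_sym oner_eq0.
rewrite /pnorm /pdeg -/(kexp F m (size P).-1).
case: pickP => [c /andP[c0]|none] /=; first by rewrite piE => /eqP ->; rewrite piC; split=> /eqP.
(* With no constant picked the symbol takes its default value 0; the congruence fails as well, since
   the constant 1 would pass the test. *)
split=> [/esym/eqP|e1]; first by rewrite oner_eq0.
by have := none 1; rewrite /= oner_neq0 piE (eqP e1) eq_sym piC eqxx.
Qed.

Lemma set_deg_fset (T : set {poly F}) N : T `<=` monic_irreducibles (F:=F) ->
  [set P | T P /\ pdeg P = N] = [set` [fset P in [seq P <- primes_deg F N | `[< T P >]]]%fset].
Proof.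
move=> TM; apply/seteqP; split=> P /=; rewrite !inE mem_filter.
  move=> [TP dP]; have [Pm Pi] := TM P TP; apply/andP; split; first exact/asboolP.
  apply/primes_degP; split => //; rewrite -dP /pdeg prednK //.
  by rewrite size_poly_gt0 monic_neq0.
by move=> /andP[/asboolP TP /primes_degP[_ _ sP]]; rewrite /pdeg sP.
Qed.

Lemma count_degE (T : set {poly F}) N : T `<=` monic_irreducibles (F:=F) ->
  count_deg T N = count (fun P => `[< T P >]) (primes_deg F N).
Proof.
move=> TM; rewrite /count_deg set_deg_fset // set_fsetK card_fseq undup_id ?size_filter //.
by rewrite filter_uniq // primes_deg_uniq.
Qed.

Lemma count_deg_irreducibles N : count_deg (monic_irreducibles (F:=F)) N = prime_count F N.
Proof.
rewrite count_degE // /prime_count -(count_predT (primes_deg F N)).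
by apply: eq_in_count => P /primes_degP[Pm Pi _]; apply/asboolP.
Qed.

Lemma count_deg_split l (D : 'I_l -> {poly F}) N :
  count_deg (residue_class1 m D) N = split_count m D N.
Proof.
rewrite count_degE => [|P []//]; apply: eq_in_count => P /primes_degP[Pm Pi sP].
apply/asboolP/forallP => [[_ PD] i|PD].
  by have /(residue_symbol_eq1 _ Pm Pi) := PD i; rewrite sP.
by split => // i; apply/(residue_symbol_eq1 _ Pm Pi); rewrite sP.
Qed.

(** The product of the x_i^(a_i) divided by G is an m-th root of c in K. It is algebraic over F_q,
    hence a constant, and so c is an m-th power in F_q. *)
Lemma power_relation_of_geometric l (D : 'I_l -> {poly F}) (K : fieldExtType {fraction {poly F}}) :
  (forall i, D i != 0) -> radical_extension m D K -> geometric_extension K ->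
  forall a, const_power_relation m D a -> power_relation m D a.
Proof.
move=> D0 [x [xm _]] geo a /(const_power_relationP m_prime D0)[c [G [c0 G0 e]]].
pose iota : {rmorphism {poly F} -> K} := (in_alg K \o @tofrac {poly F}).
pose kappa : {rmorphism F -> K} := (iota \o polyC).
have iG : iota G != 0 by rewrite fmorph_eq0 tofrac_eq0.
pose z := \prod_i x i ^+ a i / iota G.
have zm : z ^+ m = kappa c.
  rewrite expr_div_n -prodrXl (eq_bigr (fun i => iota (D i ^+ a i))); last first.
    by move=> i _; rewrite exprAC xm rmorphXn.
  by rewrite -rmorph_prod e rmorphM rmorphXn mulfK // expf_neq0.
have [|b zb] := (geo z).1.
  exists ('X^m - c%:P); first by rewrite -size_poly_eq0 size_XnsubC ?prime_gt0.
  rewrite -[map_poly _ _]/(map_poly kappa ('X^m - c%:P)) rmorphB /= map_polyXn map_polyC /=.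
  by rewrite rootE !hornerE zm subrr.
apply/asboolP; exists (b%:P * G); rewrite e exprMn -rmorphXn; congr (_%:P * _).
by apply: (fmorph_inj kappa); rewrite -zm zb rmorphXn.
Qed.

(** The exponent vectors form a subgroup of (Z/m)^l, so by Lagrange's theorem their number divides
    m^l, and m is prime. *)
Lemma gammaS_pow l (D : 'I_l -> {poly F}) : (forall i, D i != 0) ->
  exists2 r, (r <= l)%N & gammaS m D = (m ^ r)%N.
Proof.
move=> D0; case: m m_prime => [|[|m']] // pm.
pose H := [set v : 'rV['I_m'.+2]_l | power_relation m'.+2 D [ffun i => v 0 i]]%SET.
have Hg : group_set H.
  apply/group_setP; split=> [|u v].
    by rewrite inE; apply/asboolP; exists 1; rewrite big1 ?expr1n // => i _;
      rewrite ffunE mxE expr0.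
  rewrite !inE => -[G1 e1] [G2 e2].
  (* Reducing the sum of two exponent vectors modulo m drops the carries; they contribute an m-th
     power, which is divided out. *)
  pose carry (i : 'I_l) := ((u 0%R i + v 0%R i) %/ m'.+2)%N.
  have e3 : (\prod_i D i ^+ carry i) ^+ m'.+2 *
      \prod_i D i ^+ [ffun i => (u * v)%g 0 i] i = (G1 * G2) ^+ m'.+2.
    rewrite exprMn -e1 -e2 -big_split -prodrXl -big_split; apply: eq_bigr => i _ /=.
    by rewrite !ffunE !mxE -exprM -!exprD -divn_eq.
  have C0 : \prod_i D i ^+ carry i != 0 by apply/prodf_neq0 => i _; rewrite expf_neq0.
  have : (\prod_i D i ^+ carry i) ^+ m'.+2 %| (G1 * G2) ^+ m'.+2 by rewrite -e3 dvdp_mulIl.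
  rewrite dvdp_pexp2r // => /dvdpP[G3 eG]; exists G3.
  by apply: (mulfI (expf_neq0 m'.+2 C0)); rewrite e3 eG exprMn mulrC.
have : (#|H| %| m'.+2 ^ l)%N.
  by have := cardSg (finset.subsetT (Group Hg)); rewrite /= cardsT card_mx mul1n card_ord.
move/(dvdn_pfactor _ _ pm) => [r rl eH]; exists r => //; rewrite -eH /gammaS.
rewrite -[LHS]cardsE -(card_imset _ (f := fun v : 'rV_l => [ffun i => v 0 i])).
  apply: eq_card => a; rewrite inE; apply/idP/imsetP => [pa|[v vH ->]].
    exists (\row_i a i); last by apply/ffunP => i; rewrite ffunE mxE.
    by rewrite inE (_ : [ffun _ => _] = a) //; apply/ffunP => i; rewrite ffunE mxE.
  by rewrite inE in vH.
by move=> u v /ffunP e; apply/rowP => i; have := e i; rewrite !ffunE.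
Qed.

End Translation.

(** * Logarithmic series and Dirichlet density *)

Section LogarithmicSeries.
Variable R : realType.
Implicit Types (b f : nat -> R) (y d e : R).

(** The term at N = 0 is 0, as the inverse of 0 is 0. For b = 1 the series is -log(1 - y). *)
Definition log_term b y : nat -> R := fun N => b N * (y ^+ N / N%:R).

Definition log_series b y : R := limn (series (log_term b y)).

Lemma coef_bound y N : 0 < y -> y < 1 -> 0 <= y ^+ N / N%:R <= y ^+ N.
Proof.
move=> y0 y1; rewrite divr_ge0 ?exprn_ge0 ?(ltW y0) //=.
case: N => [|N]; first by rewrite invr0 mulr0.
by rewrite ler_pdivrMr ?ltr0n // ler_peMr ?exprn_ge0 ?(ltW y0) // ler1n.
Qed.

Lemma log_series_cvg b y : (forall N, 0 <= b N <= 1) -> 0 < y -> y < 1 ->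
  cvgn (series (log_term b y)).
Proof.
move=> b01 y0 y1; have c0 N := coef_bound N y0 y1.
apply: (@series_le_cvg _ _ (geometric 1 y)) => [n|n|n|].
- by have /andP[? _] := b01 n; have /andP[? _] := c0 n; rewrite mulr_ge0.
- by rewrite /geometric /= mul1r exprn_ge0 // ltW.
- have /andP[b0 b1] := b01 n; have /andP[? cy] := c0 n; rewrite /geometric /= mul1r.
  by apply: le_trans cy; rewrite ler_piMl.
by apply: is_cvg_geometric_series; rewrite ger0_norm // ltW.
Qed.

(* Summation by parts: the partial sums of 1 - mu [mu | i+1] are i mod mu. *)
Lemma periodic_sum_bound mu f n : (0 < mu)%N -> (forall i, f i.+1 <= f i) ->
  (n %% mu)%:R * f n <= \sum_(i < n) (1 - (mu * (mu %| i.+1))%:R) * f i <=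
  (n %% mu)%:R * f n + mu.-1%:R * (f 0%N - f n).
Proof.
move=> mu0 fd; elim: n => [|n /andP[lo up]].
  by rewrite big_ord0 mod0n mul0r subrr mulr0 addr0 lexx.
rewrite big_ord_recr /=; have -> : 1 - (mu * (mu %| n.+1))%:R = (n.+1 %% mu)%:R - (n %% mu)%:R :> R.
  rewrite modnS; case: ifPn => dv; last by rewrite muln0 -natr1; ring.
  rewrite muln1 sub0r -[mu in LHS](prednK mu0) -natr1.
  have -> : (n %% mu = mu.-1)%N.
    have /dvdnP[[|k] // ek] := dv.
    have -> : n = (k * mu + mu.-1)%N by apply: succn_inj; rewrite ek -addnS prednK // mulSn addnC.
    by rewrite modnMDl modn_small // ltn_predL.
  ring.
have rho : (n.+1 %% mu)%:R <= mu.-1%:R :> R by rewrite ler_nat -ltnS prednK // ltn_pmod.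
have rho0 : 0 <= (n.+1 %% mu)%:R :> R by [].
have := fd n; move: lo up rho rho0;
  move: (\sum_(i < n) _) (n.+1 %% mu)%:R (n %% mu)%:R (mu.-1)%:R => S r' r M.
move: (f n) (f n.+1) (f 0%N) => x x' x0 lo up rho rho0 xx'.
apply/andP; split; first by nra.
have : (M - r') * (x - x') >= 0 by rewrite mulr_ge0 // subr_ge0.
nra.
Qed.

(** The sequence b is compared with mu d on multiples of mu and 0 elsewhere. The first N0 terms cost
    at most 1 + mu |d| each, the later ones e times the comparison term; replacing the periodic
    pattern by its mean d costs |d| mu by [periodic_sum_bound]. *)
Lemma partial_sum_bound b mu d e N0 y n : (0 < mu)%N -> 0 <= e ->
  (forall N, 0 <= b N <= 1) ->
  (forall N, (N0 <= N)%N -> ~~ (mu %| N)%N -> b N = 0) ->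
  (forall N, (N0 <= N)%N -> (mu %| N)%N -> `|b N - mu%:R * d| <= e) ->
  0 < y -> y < 1 ->
  `|series (log_term b y) n.+1 - d * series (log_term (fun=> 1) y) n.+1| <=
    N0%:R * (1 + mu%:R * `|d|) + `|d| * mu%:R + e * series (log_term (fun=> 1) y) n.+1.
Proof.
move=> mu0 e0 b01 b0 bd y0 y1.
pose t N := y ^+ N / N%:R; have t01 N := coef_bound N y0 y1.
pose r N := b N - d * (mu * (mu %| N))%:R.
have -> : series (log_term b y) n.+1 - d * series (log_term (fun=> 1) y) n.+1 =
    \sum_(0 <= N < n.+1) r N * t N - d * \sum_(0 <= N < n.+1) (1 - (mu * (mu %| N))%:R) * t N.
  rewrite /series /= !mulr_sumr -!sumrB; apply: eq_bigr => N _.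
  by rewrite /log_term /r -/(t N); ring.
rewrite -addrA [X in _ <= X](_ : _ =
  (N0%:R * (1 + mu%:R * `|d|) + e * series (log_term (fun=> 1) y) n.+1) + `|d| * mu%:R); last by ring.
rewrite (le_trans (ler_normB _ _)) // lerD //; last first.
  rewrite normrM ler_wpM2l //.
  rewrite big_nat_recl // {1}/t invr0 !mulr0 add0r big_mkord.
  have := @periodic_sum_bound mu (fun i => t i.+1) n mu0.
  move=> /(_ _)/andP[|lo up].
    move=> i; rewrite /t ler_pM ?exprn_ge0 ?invr_ge0 ?(ltW y0) //.
      by rewrite [X in X <= _]exprS ler_piMl ?exprn_ge0 ?(ltW y0) ?(ltW y1).
    by rewrite lef_pV2 ?posrE ?ltr0n // ler_nat.
  have /andP[t1 t2] := t01 n.+1; rewrite -/(t n.+1) in t1.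
  have yn : y ^+ n.+1 <= 1 by rewrite exprn_ile1 // ltW.
  have tn1 : t n.+1 <= 1 by rewrite (le_trans t2).
  rewrite ger0_norm; last by rewrite (le_trans _ lo) // mulr_ge0.
  apply: (le_trans up); rewrite -[mu in X in _ <= X](prednK mu0) -natr1.
  have rho : (n %% mu)%:R <= mu.-1%:R :> R by rewrite ler_nat -ltnS prednK // ltn_pmod.
  have t11 : t 1%N <= 1 by rewrite /t invr1 mulr1 expr1 ltW.
  have M0 : 0 <= mu.-1%:R :> R by [].
  by move: (mu.-1%:R) (n %% mu)%:R (t 1%N) (t n.+1) rho t11 M0 t1 => *; nra.
rewrite (le_trans (ler_norm_sum _ _ _)) //.
have -> : N0%:R * (1 + mu%:R * `|d|) + e * series (log_term (fun=> 1) y) n.+1 =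
    (1 + mu%:R * `|d|) * N0%:R + \sum_(0 <= N < n.+1) e * t N.
  by rewrite /series /= mulrC mulr_sumr; congr (_ + _); apply: eq_bigr => N _;
    rewrite /log_term mul1r.
have K0 : 0 <= 1 + mu%:R * `|d| by rewrite addr_ge0 // mulr_ge0.
have cnt : \sum_(0 <= N < n.+1) ((N < N0)%N%:R : R) <= N0%:R.
  rewrite -natr_sum ler_nat; elim: n.+1 => [|k IH]; first by rewrite big_nil.
  have -> : (\sum_(0 <= N < k.+1) (N < N0) = minn k.+1 N0)%N; last exact: geq_minr.
  elim: k.+1 => [|j IHj]; first by rewrite big_nil min0n.
  by rewrite big_nat_recr //= IHj; case: ltnP => ?; lia.
apply: (@le_trans _ _ (\sum_(0 <= N < n.+1) ((1 + mu%:R * `|d|) * (N < N0)%N%:R + e * t N))).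
  apply: ler_sum => N _; have /andP[tN0 tNy] := t01 N; rewrite -/(t N) in tN0 tNy.
  rewrite normrM (ger0_norm tN0); case: ltnP => NN0.
    rewrite mulr1 -[X in X <= _]addr0 lerD ?(mulr_ge0 e0 tN0) //.
    have tN1 : t N <= 1 by rewrite (le_trans tNy) // exprn_ile1 // ltW.
    rewrite -[X in _ <= X]mulr1 ler_pM //.
    rewrite /r (le_trans (ler_normB _ _)) // lerD //.
      by have /andP[? ?] := b01 N; rewrite ger0_norm.
    rewrite normrM mulrC ler_wpM2r // normr_nat ler_nat.
    by case: (mu %| N)%N; rewrite ?muln1 ?muln0.
  rewrite mulr0 add0r ler_wpM2r //.
  have [dv|ndv] := boolP (mu %| N)%N; first by rewrite /r dv muln1 mulrC bd.
  by rewrite /r (negbTE ndv) muln0 mulr0 subr0 b0 // normr0.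
by rewrite big_split /= lerD // -mulr_sumr ler_wpM2l.
Qed.

(** C does not depend on y, so it becomes negligible when the comparison series diverges as y tends
    to 1. *)
Lemma log_series_bound b mu d : (0 < mu)%N ->
  (forall N, 0 <= b N <= 1) ->
  (exists N0, forall N, (N0 <= N)%N -> ~~ (mu %| N)%N -> b N = 0) ->
  tends (dvdn mu) b (mu%:R * d) ->
  forall e, 0 < e -> exists C, forall y, 0 < y -> y < 1 ->
  `|log_series b y - d * log_series (fun=> 1) y| <= C + e * log_series (fun=> 1) y.
Proof.
move=> mu0 b01 [N1 b0] bd e e0; have [N2 bN] := bd e e0.
pose N0 := maxn N1 N2; exists (N0%:R * (1 + mu%:R * `|d|) + `|d| * mu%:R) => y y0 y1.
have cb := log_series_cvg b01 y0 y1.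
have c1 : cvgn (series (log_term (fun=> 1) y)) by apply: log_series_cvg => // N; rewrite ler01 lexx.
apply: (@ler_cvg_to _ \oo _ _ (fun n => `|series (log_term b y) n.+1 - d * series (log_term (fun=> 1) y) n.+1|)
  (fun n => N0%:R * (1 + mu%:R * `|d|) + `|d| * mu%:R + e * series (log_term (fun=> 1) y) n.+1)).
- apply: cvg_norm; apply: cvgB.
    by move: cb => /cvg_ex[l cl]; rewrite /log_series (cvg_lim _ cl) //; rewrite -cvg_shiftS in cl.
  apply: cvgMr; move: c1 => /cvg_ex[l cl]; rewrite /log_series (cvg_lim _ cl) //.
  by rewrite -cvg_shiftS in cl.
- apply: cvgD; first exact: cvg_cst.
  apply: cvgMr; move: c1 => /cvg_ex[l cl]; rewrite /log_series (cvg_lim _ cl) //.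
  by rewrite -cvg_shiftS in cl.
apply: nearW => n; apply: partial_sum_bound => //; first exact: ltW.
- by move=> N; rewrite geq_max => /andP[? _]; exact: b0.
- by move=> N; rewrite geq_max => /andP[_ ?]; exact: bN.
Qed.

Lemma log_series_dvg (K : R) : exists2 eta : R, 0 < eta &
  forall y, 0 < y -> 1 - eta < y -> y < 1 -> K <= log_series (fun=> 1) y.
Proof.
have : series (@harmonic R) @ \oo --> +oo.
  apply: nondecreasing_dvgn_lt; last exact: dvg_harmonic.
  by apply: nondecreasing_series => n _ _; exact: harmonic_ge0.
move=> /cvgryPge /(_ (2 * `|K|)) [n _ /(_ n (leqnn n)) /= Hn].
have n0 : 0 < (2 * n.+1%:R)^-1 :> R by rewrite invr_gt0 mulr_gt0 // ltr0n.
exists (2 * n.+1%:R)^-1 => // y y0 ey y1.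
have c1 : cvgn (series (log_term (fun=> 1) y)) by apply: log_series_cvg => // N; rewrite ler01 lexx.
apply: (@le_trans _ _ (series (log_term (fun=> 1) y) n.+1)); last first.
  apply: nondecreasing_cvgn_le => //; apply: nondecreasing_series => k _ _.
  by rewrite /log_term mul1r; have /andP[] := coef_bound k y0 y1.
(* The choice of eta gives n (1 - y) <= 1/2, and Bernoulli's inequality gives y^n >= 1/2. The
   partial sum is then at least half the harmonic sum, which was made at least 2 |K|. *)
have yn : 2^-1 <= y ^+ n.
  have bern k : 1 - k%:R * (1 - y) <= y ^+ k.
    elim: k => [|k IH]; first by rewrite mul0r subr0 expr0.
    rewrite exprS -natr1; have k0 : 0 <= k%:R :> R by [].
    have := ler_wpM2l (ltW y0) IH; apply: le_trans; move: k%:R k0 => x x0.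
    by have : 0 <= x * (1 - y) ^+ 2; [rewrite mulr_ge0 // sqr_ge0|nra].
  apply: le_trans (bern n); have : (1 - y) * (2 * n.+1%:R) <= 1.
    by rewrite -ler_pdivlMr ?mulr_gt0 ?ltr0n // mul1r lerBlDl -lerBlDr ltW.
  by rewrite -[n.+1%:R]natr1; move: n%:R (ler0n R n) => x x0; nra.
rewrite /series /= big_nat_recl // /log_term invr0 !mulr0 add0r.
apply: (@le_trans _ _ (2^-1 * series harmonic n)).
  by rewrite (le_trans (ler_norm K)) // -ler_pdivrMl ?invr_gt0 // invrK.
rewrite /series /= mulr_sumr; apply: ler_sum_nat => i /andP[_ ilt].
rewrite mul1r /harmonic /= ler_wpM2r ?invr_ge0 // (le_trans yn) //.
by rewrite ler_wiXn2l ?ltW.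
Qed.

End LogarithmicSeries.

(** * Sums of NP^(-s) as power series in q^(1-s) *)

Section DirichletSeries.
Variables (R : realType) (F : finFieldType).
Local Notation q := #|F|.
Implicit Types (T : set {poly F}) (s : R).

Let q_gt1 : 1 < q%:R :> R. Proof. by rewrite ltr1n finNzRing_gt1. Qed.
Let q_gt0 : 0 < q%:R :> R. Proof. exact: lt_trans q_gt1. Qed.

(** With y for this quantity, the sum of NP^(-s) over the P of degree N is the normalized count
    times y^N/N, and y tends to 1 from below as s tends to 1 from above. *)
Definition zeta_arg s : R := q%:R `^ (1 - s).

Lemma zeta_arg_gt0 s : 0 < zeta_arg s. Proof. exact: powR_gt0. Qed.

Lemma zeta_arg_ge s : 1 - (s - 1) * ln q%:R <= zeta_arg s.
Proof.
rewrite /zeta_arg /powR gt_eqF //; have := expR_ge1Dx ((1 - s) * ln (q%:R : R)).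
have -> : 1 - (s - 1) * ln q%:R = 1 + (1 - s) * ln q%:R :> R by ring.
exact.
Qed.

Lemma zeta_arg_lt1 s : 1 < s -> zeta_arg s < 1.
Proof.
move=> s1; rewrite /zeta_arg /powR gt_eqF // -[X in _ < X]expR0 ltr_expR.
by rewrite pmulr_llt0 ?subr_lt0 // ln_gt0.
Qed.

Lemma pnorm_powR s N : (q ^ N)%:R `^ (- s) = zeta_arg s ^+ N / (q ^ N)%:R :> R.
Proof.
rewrite natrX -expr_div_n -[in LHS]powR_mulrn ?ltW // powRAC powR_mulrn ?powR_ge0 //.
by congr (_ ^+ _); rewrite /zeta_arg powRD ?(gt_eqF q_gt0) ?implybT // powRr1 ?ltW // mulrAC divff ?mul1r // gt_eqF.
Qed.

Lemma count_deg_le T N : T `<=` monic_irreducibles (F:=F) -> (count_deg T N <= prime_count F N)%N.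
Proof. by move=> TM; rewrite count_degE // count_size. Qed.

Lemma normalized_count_deg01 T N : T `<=` monic_irreducibles (F:=F) ->
  0 <= normalized R F (count_deg T) N <= 1.
Proof.
move=> TM; rewrite normalized_ge0 /=; apply: le_trans (normalized_prime_le1 R F N).
by apply: normalized_le; exact: count_deg_le.
Qed.

Lemma count_deg0 T : T `<=` monic_irreducibles (F:=F) -> count_deg T 0 = 0%N.
Proof.
move=> TM; apply/eqP; rewrite -leqn0 (leq_trans (count_deg_le 0 TM)) //.
rewrite /prime_count leqn0 size_eq0; apply/eqP.
have no P : P \notin primes_deg F 0.
  by apply/negP => /primes_degP[_ [s1 _] s0]; rewrite s0 in s1.
by case: (primes_deg F 0) no => // P p /(_ P); rewrite mem_head.
Qed.

(** Summation by degree: the P of fixed degree form finite sets that partition T, and all terms are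
    nonnegative. *)
Lemma prime_zetaE T s : T `<=` monic_irreducibles (F:=F) -> 1 < s ->
  prime_zeta T s = log_series (normalized R F (count_deg T)) (zeta_arg s).
Proof.
move=> TM s1; pose J N := [set P | T P /\ pdeg P = N].
pose u := log_term (normalized R F (count_deg T)) (zeta_arg s).
have uE N : \esum_(P in J N) ((pnorm P)%:R `^ (- s))%:E = (u N)%:E.
  have JN := set_deg_fset N TM; have finJ : finite_set (J N) by rewrite /J JN; exact: finite_fset.
  rewrite esum_fset //.
  rewrite fsumEFin // fsbig_finite //=; congr (_%:E).
  transitivity (\sum_(P <- fset_set (J N)) (q ^ N)%:R `^ (- s) : R).
    rewrite big_seq [RHS]big_seq; apply: eq_bigr => P; rewrite in_fset_set // inE => -[_ dP].
    by rewrite /pnorm dP.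
  rewrite big_const_seq count_predT iter_addr_0 -[size _]/(count_deg T N) -[_ *+ _]mulr_natl.
  rewrite pnorm_powR /u /log_term /normalized; have [->|N0] := posnP N.
    by rewrite count_deg0 // mul0r mul0n !mul0r.
  have Nn : N%:R != 0 :> R by rewrite pnatr_eq0 -lt0n.
  have cancel (c z Q n : R) : n * c / Q * (z / n) = n / n * (c * (z / Q)) by ring.
  by rewrite natrM cancel divff // mul1r.
have u0 N : (0 <= (u N)%:E)%E.
  by rewrite -uE; apply: esum_ge0 => P _; rewrite lee_fin powR_ge0.
have TJ : T = \bigcup_(N in setT) J N.
  by apply/seteqP; split => [P TP|P [N _ []]//]; exists (pdeg P).
rewrite /prime_zeta {1}TJ esum_bigcupT //.
  rewrite (eq_esum (b := fun N => (u N)%:E)) //.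
  rewrite -nneseries_esumT //.
  rewrite (_ : (fun n => _) = EFin \o series u); last by apply/funext => n /=; rewrite sumEFin.
  rewrite EFin_lim //; apply: log_series_cvg; [|exact: zeta_arg_gt0|exact: zeta_arg_lt1].
  by move=> N; exact: normalized_count_deg01.
apply/trivIsetP => i j _ _ ij; apply/seteqP; split=> // P [[_ e1] [_ e2]].
by move: ij; rewrite -e1 -e2 eqxx.
Qed.

Lemma near_zeta_arg (K : R) : \forall s \near (1 : R)^'+, K <= log_series (fun=> 1) (zeta_arg s).
Proof.
have [eta eta0 Keta] := log_series_dvg K.
have l0 : 0 < ln q%:R :> R by rewrite ln_gt0.
near=> s; have s1 : 1 < s by near: s; exact: nbhs_right_gt.
have se : s - 1 < eta / ln q%:R by near: s; apply: nbhs_right_ltDr; rewrite divr_gt0.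
apply: Keta; [exact: zeta_arg_gt0| |exact: zeta_arg_lt1].
by rewrite (lt_le_trans _ (zeta_arg_ge s)) // ltrD2l ltrN2 -ltr_pdivlMr.
Unshelve. all: by end_near. Qed.

(** The case mu = 1 is for counts that converge along all N, mu = m for counts supported on
    multiples of m, where the limit is mu times the mean d. Dividing by the divergent comparison
    series removes the constant of [log_series_bound]. *)
Lemma prime_zeta_ratio T mu (d : R) : T `<=` monic_irreducibles (F:=F) -> (0 < mu)%N ->
  (exists N0, forall N, (N0 <= N)%N -> ~~ (mu %| N)%N -> count_deg T N = 0%N) ->
  tends (dvdn mu) (normalized R F (count_deg T)) (mu%:R * d) ->
  prime_zeta T s / log_series (fun=> 1) (zeta_arg s) @[s --> (1 : R)^'+] --> d.
Proof.
move=> TM mu0 [N0 c0] cd; apply/cvgrPdist_le => e e0.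
have e2 : 0 < e / 2 by rewrite divr_gt0.
have [|C bC] := @log_series_bound R _ mu d mu0 (fun N => normalized_count_deg01 N TM) _ cd _ e2.
  by exists N0 => N N0N nd; rewrite /normalized c0 // muln0 mul0r.
near=> s; have s1 : 1 < s by near: s; exact: nbhs_right_gt.
have L1 : 1 <= log_series (fun=> 1) (zeta_arg s) by near: s; exact: near_zeta_arg.
have LC : C / (e / 2) <= log_series (fun=> 1) (zeta_arg s) by near: s; exact: near_zeta_arg.
have L0 : 0 < log_series (fun=> 1) (zeta_arg s) by rewrite (lt_le_trans _ L1).
rewrite prime_zetaE //; have := bC _ (zeta_arg_gt0 s) (zeta_arg_lt1 s1).
move: L0 LC; move: (log_series _ _) (log_series _ _) => Z L L0 LC bnd.
rewrite distrC -(ler_pM2r L0) -[X in _ * X <= _](gtr0_norm L0) -normrM mulrBl divfK ?gt_eqF //.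
rewrite (le_trans bnd) // [X in _ <= X * _]splitr mulrDl lerD2r.
by rewrite mulrC -ler_pdivrMr.
Unshelve. all: by end_near. Qed.

(** The ratio for T is divided by the ratio for all monic irreducibles, to which [prime_zeta_ratio]
    applies with mu = 1 and d = 1. *)
Lemma dirichlet_density_of_counts T mu (d : R) : T `<=` monic_irreducibles (F:=F) -> (0 < mu)%N ->
  (exists N0, forall N, (N0 <= N)%N -> ~~ (mu %| N)%N -> count_deg T N = 0%N) ->
  tends (dvdn mu) (normalized R F (count_deg T)) (mu%:R * d) ->
  has_dirichlet_density T d.
Proof.
move=> TM mu0 c0 cd; have ZT := prime_zeta_ratio TM mu0 c0 cd.
have ZM : prime_zeta (monic_irreducibles (F:=F)) s / log_series (fun=> 1) (zeta_arg s) @[s --> (1 : R)^'+] --> (1 : R).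
  apply: (@prime_zeta_ratio _ 1) => //; first by exists 0%N => N _; rewrite dvd1n.
  rewrite mulr1; apply: (@tends_eq _ _ (normalized R F (prime_count F)) _ _ 0).
    by move=> N _ _; rewrite /normalized count_deg_irreducibles.
  by apply: (@tends_sub _ _ predT) => //; exact: normalized_prime_tends.
have lim : (prime_zeta T s / log_series (fun=> 1) (zeta_arg s)) /
    (prime_zeta (monic_irreducibles (F:=F)) s / log_series (fun=> 1) (zeta_arg s))
    @[s --> (1 : R)^'+] --> d / 1.
  by apply: cvgM ZT (cvgV _ ZM); exact: oner_neq0.
rewrite divr1 in lim; apply: cvg_trans lim; apply: near_eq_cvg; near=> s.
have L1 : 1 <= log_series (fun=> 1) (zeta_arg s) by near: s; exact: near_zeta_arg.
have L0 : log_series (fun=> 1) (zeta_arg s) != 0 by rewrite gt_eqF // (lt_le_trans _ L1).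
by rewrite /= invf_div mulrA divfK.
Unshelve. all: by end_near. Qed.

Lemma relative_density_of_counts T (d : R) :
  tends predT (normalized R F (count_deg T)) d -> has_relative_density T d.
Proof.
move=> cd; have cvg_tends (v : nat -> R) x : tends predT v x -> v @ \oo --> x.
  move=> vx; apply/cvgrPdist_le => e e0; have [N0 vN] := vx e e0.
  by exists N0 => // N /= N0N; rewrite distrC vN.
have lim : normalized R F (count_deg T) N / normalized R F (prime_count F) N
    @[N --> \oo] --> d / 1.
  apply: cvgM (cvg_tends _ _ cd) (cvgV _ (cvg_tends _ _ (@normalized_prime_tends R F))).
  exact: oner_neq0.
rewrite divr1 in lim; apply: cvg_trans lim; apply: near_eq_cvg; near=> N.
have N0 : (0 < N)%N by near: N; exact: nbhs_infty_gt.
rewrite /= /normalized -count_deg_irreducibles !natrM.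
have Nn : N%:R != 0 :> R by rewrite pnatr_eq0 -lt0n.
have Qn : (q ^ N)%:R != 0 :> R by rewrite gt_eqF // qN_gt0.
move: (count_deg _ N)%:R (count_deg _ N)%:R (N%:R) (q ^ N)%:R Nn Qn => a b n Q Nn Qn.
(* If the denominator counts no irreducible, both quotients are 0, as the inverse of 0 is 0. *)
have [->|a0] := eqVneq a 0; first by rewrite mulr0 mul0r invr0 !mulr0.
by field; rewrite Nn Qn a0.
Unshelve. all: by end_near. Qed.

End DirichletSeries.

Theorem theorem4p2 (R : realType) (F : finFieldType) (m l : nat)
    (m_prime : prime m) (m_dvd : (m %| #|F|.-1)%N)
    (D : 'I_l -> {poly F}) (D_inj : injective D) (D_neq0 : forall i, D i != 0) :
  exists r : nat,
    [/\ (m ^ r)%N = gammaS m D,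
        has_dirichlet_density (residue_class1 m D)
          (1 / m%:R ^+ (l - r) : R)
      & forall K : fieldExtType {fraction {poly F}},
          radical_extension m D K -> geometric_extension K ->
          has_relative_density (residue_class1 m D)
            (1 / m%:R ^+ (l - r) : R)].
Proof.
have [r rl gr] := gammaS_pow m_prime D_neq0; exists r.
have TM : residue_class1 m D `<=` monic_irreducibles (F:=F) by move=> P [].
have -> : 1 / m%:R ^+ (l - r) = relation_density R m D.
  have m0 : m%:R != 0 :> R by rewrite pnatr_eq0 -lt0n prime_gt0.
  rewrite /relation_density gr !natrX -{2}(subnK rl) exprD; field.
  by rewrite !expf_neq0.
have split_tends A c : tends A (normalized R F (split_count m D)) c ->
    tends A (normalized R F (count_deg (residue_class1 m D))) c.
  by apply: (@tends_eq _ _ _ _ _ 0) => N _ _; rewrite /normalized (count_deg_split m_dvd).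
split; first by rewrite gr.
  (* A relation that holds only up to a constant confines the completely split P of large degree to
     degrees divisible by m, and mu = m is used. Otherwise the counts converge along all N and mu =
     1. *)
  have [[a [ca pa]]|no] := EM (exists a, const_power_relation m D a /\ ~~ power_relation m D a).
    have [[N0 z] t] := split_count_nongeometric R m_prime m_dvd D_neq0 ca pa.
    apply: (dirichlet_density_of_counts TM (prime_gt0 m_prime)); last exact: split_tends.
    by exists N0 => N; rewrite (count_deg_split m_dvd); exact: z.
  apply: (dirichlet_density_of_counts TM (ltn0Sn 0)); first by exists 0%N => N _; rewrite dvd1n.
  rewrite mul1r; apply: split_tends; apply: (@tends_sub _ _ predT) => //.
  apply: split_count_geometric => // a ca; apply: contrapT => /negP pa.
  by apply: no; exists a.
move=> K rad geo; apply: relative_density_of_counts; apply: split_tends.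
by apply: split_count_geometric => //; exact: power_relation_of_geometric rad geo.
Qed.
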